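(* Let $P$ be a bounded ordered set with at least two elements, and let $G$ be an arbitrary group. Then there exists a selfdual lattice $L$ of length sixteen such that the ordered set $\langle \mathrm{Princ}(L);\subseteq\rangle$ of principal congruences of $L$ is order isomorphic to $P$ and the automorphism group $\mathrm{Aut}(L)$ is isomorphic to $G$.
   Context: Ordered set means partially ordered set; it is bounded if it has a least element $0$ and a greatest element $1$. Neither $P$ nor $G$ is assumed to be finite. For a lattice $L$ and $a,b\in L$, $\mathrm{con}(a,b)$ denotes the smallest (lattice) congruence of $L$ that contains the pair $\langle a,b\rangle$; the congruences of this form are the principal congruences of $L$. $\mathrm{Princ}(L)=\{\mathrm{con}(a,b): a,b\in L\}$ denotes the set of principal congruences of $L$, ordered by set inclusion $\subseteq$. $\mathrm{Aut}(L)$ denotes the group of all lattice automorphisms of $L$ under composition. A lattice is selfdual if it is isomorphic to its dual, that is, to the lattice obtained by reversing the order. A lattice has length $n$ if it has a chain with $n+1$ elements and has no chain with more than $n+1$ elements. *)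

(* Defs.v *)
From HB Require Import structures.
From mathcomp Require Import all_boot all_order.
From mathcomp Require Import boolp classical_sets functions cardinality.

Set Implicit Arguments.
Unset Strict Implicit.
Unset Printing Implicit Defensive.

Import Order.TTheory.
Local Open Scope classical_set_scope.
Local Open Scope order_scope.

Record congruence d (L : latticeType d) (theta : set (L * L)) : Prop :=
  Congruence {
    congruence_refl : forall x, theta (x, x);
    congruence_sym : forall x y, theta (x, y) -> theta (y, x);
    congruence_trans : forall x y z,
      theta (x, y) -> theta (y, z) -> theta (x, z);
    congruence_meet : forall x1 y1 x2 y2,
      theta (x1, y1) -> theta (x2, y2) -> theta (x1 `&` x2, y1 `&` y2);
    congruence_join : forall x1 y1 x2 y2,
      theta (x1, y1) -> theta (x2, y2) -> theta (x1 `|` x2, y1 `|` y2)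
  }.

Definition con d (L : latticeType d) (a b : L) : set (L * L) :=
  smallest (@congruence d L) [set (a, b)].

Definition Princ d (L : latticeType d) : set (set (L * L)) :=
  [set theta | exists a b : L, theta = con a b].
Arguments Princ {d} L.

Definition lattice_isomorphism d d' (L : latticeType d) (M : latticeType d')
    (f : L -> M) : Prop :=
  [/\ bijective f, Order.meet_morphism f & Order.join_morphism f].

Definition Aut d (L : latticeType d) : set (L -> L) :=
  [set f | lattice_isomorphism f].
Arguments Aut {d} L.

Definition group_isomorphic_Aut (G : groupType) d (L : latticeType d) : Prop :=
  exists phi : G -> L -> L,
    set_bij [set: G] (Aut L) phi /\
    forall g h : G, phi (g * h)%g = phi g \o phi h.

Definition order_isomorphic_Princ d (L : latticeType d) d' (P : porderType d')
    : Prop :=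
  exists f : P -> set (L * L),
    set_bij [set: P] (Princ L) f /\
    forall x y : P, (x <= y) <-> (f x `<=` f y)%classic.

Definition selfdual d (L : latticeType d) : Prop :=
  exists f : L -> L^d, lattice_isomorphism f.

Definition chain d (L : porderType d) (C : set L) : Prop :=
  total_on C (fun x y : L => x <= y).

(* Chains may be infinite, hence the comparison of cardinals in the second
   part rather than a bound on finite sequences. *)
Definition has_length d (L : porderType d) (n : nat) : Prop :=
  (exists C : set L, chain C /\ (C #= `I_n.+1)%card) /\
  (forall C : set L, chain C -> (C #<= `I_n.+1)%card).

(* Main.v *)
Require Import Defs.
From HB Require Import structures.
From mathcomp Require Import all_boot all_order.
From mathcomp Require Import boolp classical_sets functions cardinality.
From mathcomp Require Import wochoice zify.
From Stdlib Require Import Lia.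

(* Let K be an ordered set with pieces glued along common elements, and let L
   consist of K, a dual copy of K, a least and a greatest element.  Each inner
   p in P contributes to K an edge a_p < b_p (Hub), and each p < q a block
   (Gate) in which the joins of a_p, b_p with a_q, b_q are a < b < i with
   a = a_p v a_q, b = b_p v a_q and i = a_p v b_q = b_p v b_q; hence collapsing
   a_q, b_q collapses a, i, and meeting with b_p collapses a_p, b_p.  The
   converse fails.  Any comparable pair x < y that lies neither in such an edge nor
   in such a chain a < b < i, nor in their duals, is separated by an atom below y
   but not below x, or dually by a coatom, and collapsing an atom with 0
   collapses L.
   The automorphisms are controlled by an atom for each "colour" in the disjoint
   union of G and P: a well-order of the colours is coded by blocks containing
   long chains, which are also what makes the length sixteen, so every
   automorphism fixes the colours and everything attached to them.  What can move
   is a coloured net: points (g, false), (h, true) and a line through each two of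
   them, coloured g^-1 h, so that exactly the left translations of G survive.
   The order is free of 4-crowns, which makes L a lattice, and the dual copy,
   attached above K at the edges a_p < b_p and at the points (g, false), makes L
   selfdual. *)

Set Implicit Arguments.
Unset Strict Implicit.
Unset Printing Implicit Defensive.

Import Order.TTheory.
Local Open Scope classical_set_scope.

(** * Well-orders *)

Section WellOrder.
Context (T : eqType).

Definition wo_le : rel T := sval (well_ordering_principle T).
Definition wo_lt (x y : T) : Prop := wo_le x y /\ x <> y.

Let wo_min (A : T -> Prop) : (exists x, A x) ->
  exists z, A z /\ forall x, A x -> wo_le z x.
Proof.
move=> [x Ax].
have [|z [[/asboolP Az lbz] _]] :=
    svalP (well_ordering_principle T) [pred y | `[< A y >]].
  by exists x; apply/asboolP.
by exists z; split=> // y Ay; apply/lbz/asboolP.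
Qed.

Lemma wo_le_total x y : wo_le x y \/ wo_le y x.
Proof.
have [|z [[->|->] zP]] := @wo_min (fun z => z = x \/ z = y).
- by exists x; left.
- by left; apply: zP; right.
- by right; apply: zP; left.
Qed.

Lemma wo_lexx x : wo_le x x.
Proof. by case: (wo_le_total x x). Qed.

Lemma wo_le_anti x y : wo_le x y -> wo_le y x -> x = y.
Proof.
move=> xy yx.
(* The principle makes the least element of a set unique, and both [x] and [y] are least in the set
   of the two. *)
have [|z [_ zU]] := svalP (well_ordering_principle T) [pred z | z \in [:: x; y]].
  by exists x; rewrite !inE eqxx.
rewrite -(zU x); last first.
  by split=> [|u]; rewrite !inE ?eqxx// => /orP[]/eqP->//; apply: wo_lexx.
apply: zU; split=> [|u]; first by rewrite !inE eqxx orbT.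
by rewrite !inE => /orP[]/eqP->//; apply: wo_lexx.
Qed.

Lemma wo_lt_asym x y : wo_lt x y -> wo_lt y x -> False.
Proof. by move=> [xy nxy] [yx _]; apply: nxy; apply: wo_le_anti. Qed.

Lemma wo_lt_total x y : x <> y -> wo_lt x y \/ wo_lt y x.
Proof. by move=> nxy; case: (wo_le_total x y); [left|right]; split=> // /esym. Qed.

(* Otherwise f would move the least element it moves below itself. *)
Lemma wo_auto_id (f g : T -> T) : cancel f g -> cancel g f ->
  (forall x y, wo_lt x y -> wo_lt (f x) (f y)) ->
  (forall x y, wo_lt x y -> wo_lt (g x) (g y)) -> f =1 id.
Proof.
move=> fK gK fmono gmono x; apply: contrapT => nx.
have [|z [/= fz zmin]] := @wo_min (fun x => f x <> x); first by exists x.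
have fixlt y : wo_lt y z -> f y = y.
  move=> [yz nyz]; apply: contrapT => /zmin zy.
  by apply: nyz; apply: wo_le_anti.
case: (wo_lt_total fz) => lt_z.
- by apply: fz; apply: (can_inj fK); apply: fixlt.
- have gz : wo_lt (g z) z by rewrite -{2}[z]fK; apply: gmono.
  have := fixlt _ gz; rewrite gK => /esym e.
  by apply: fz; rewrite -{2}[z]gK e.
Qed.

End WellOrder.

(** * The ordered set *)

Ltac inv_hyps := repeat match goal with
  | H : _ /\ _ |- _ => destruct H
  | H : _ \/ _ |- _ => destruct H
  | H : exists _, _ |- _ => destruct H
  | H : False |- _ => destruct H
  | H : ?x = ?x |- _ => clear H
  | H : @inl _ _ _ = inl _ |- _ => injection H as H
  | H : @inr _ _ _ = inr _ |- _ => injection H as H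
  | H : @inl _ _ _ = inr _ |- _ => discriminate H
  | H : @inr _ _ _ = inl _ |- _ => discriminate H
  | H : true = false |- _ => discriminate H
  | H : false = true |- _ => discriminate H
  end; subst.

Ltac solve_lia := solve [repeat match goal with |- _ /\ _ => split end;
  first [lia | congruence | assumption]].
Ltac order_solve := solve [solve_lia | left; solve_lia | right; solve_lia
  | left; left; solve_lia | left; right; solve_lia
  | right; left; solve_lia | right; right; solve_lia].

Section Construction.
Context {dP : Order.disp_t} {P : tbPOrderType dP} {G : groupType}.

Definition color := (G + P)%type.

(* For s before t, Chain s t 0 < ... < Chain s t 13 lies above the colour t, but
   only its last element lies above s; this orients the pair, and each
   Tag s t j is an atom separating two consecutive elements.  Vert and Edge are
   the points and lines of the net, coloured through inl; Hub p 0 < Hub p 1 is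
   the edge a_p < b_p, tied by Link p to the colour inr p; Gate p q k for k < 3
   is a < b < i.  The range of the indices is imposed by low_valid. *)
Inductive low : Type :=
| Color of color
| Chain of color & color & nat
| Tag of color & color & nat
| Vert of bool & G
| Edge of G & G
| Hub of P & nat
| Link of P
| Gate of P & P & nat.

Definition inner (p : P) : Prop := p <> \bot%O /\ p <> \top%O.

Definition low_valid (x : low) : Prop :=
  match x with
  | Chain s t j => wo_lt s t /\ (j < 14)
  | Tag s t j => wo_lt s t /\ (j < 13)
  | Hub p k => inner p /\ (k < 2)
  | Link p => inner p
  | Gate p q k => inner p /\ inner q /\ (p < q)%O /\ (k < 3)
  | _ => True
  end.

Definition low_le (x y : low) : Prop :=
  match x, y with
  | Color s, Color s' => s = s'
  | Color s, Chain s' t' j => s = t' \/ (s = s' /\ (13 <= j))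
  | Color s, Edge g h => s = inl (g^-1 * h)%g
  | Color s, Link p => s = inr p
  | Chain s t j, Chain s' t' j' => s = s' /\ t = t' /\ (j <= j')
  | Tag s t j, Tag s' t' j' => s = s' /\ t = t' /\ j = j'
  | Tag s t j, Chain s' t' j' => s = s' /\ t = t' /\ (j <= j')
  | Vert b g, Vert b' g' => b = b' /\ g = g'
  | Vert b g, Edge g' h' => g = if b then h' else g'
  | Edge g h, Edge g' h' => g = g' /\ h = h'
  | Hub p k, Hub p' k' => p = p' /\ (k <= k')
  | Hub p k, Link p' => p = p'
  | Hub p k, Gate r s k' =>
      (p = r /\ (k <= k')) \/ (p = s /\ (2 * k <= k'))
  | Link p, Link p' => p = p'
  | Gate p q k, Gate p' q' k' => p = p' /\ q = q' /\ (k <= k')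
  | _, _ => False
  end.

(** For inner [p], the elements [Hub p 0], [Hub p 1] and their duals form a square whose opposite
    sides are the edge of [p] and the dual edge, so these collapse together. The relation at
    [Vert false g] ties the translation of the dual copy to that of the original, and tells the two
    kinds of points apart. *)
Definition below_dual (x y : low) : Prop :=
  match x, y with
  | Hub p k, Hub p' k' => p = p' /\ (k + k' <= 1)
  | Vert false g, Vert false g' => g = g'
  | _, _ => False
  end.

(* Hi x is the dual copy of x. *)
Inductive raw : Type := Bot | Top | Lo of low | Hi of low.

Definition raw_valid (x : raw) : Prop :=
  match x with Lo x | Hi x => low_valid x | _ => True end.

Definition raw_le (x y : raw) : Prop :=
  match x, y with
  | Bot, _ => True
  | _, Top => True
  | Lo x, Lo y => low_le x y
  | Hi x, Hi y => low_le y x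
  | Lo x, Hi y => below_dual x y
  | _, _ => False
  end.

Definition raw_star (x : raw) : raw :=
  match x with Bot => Top | Top => Bot | Lo x => Hi x | Hi x => Lo x end.

Lemma lt_asymP (p q : P) : (p < q)%O -> (q < p)%O -> False.
Proof. by move=> pq /(lt_trans pq); rewrite ltxx. Qed.

Lemma low_le_refl x : low_le x x.
Proof. by case: x => [s|s t j|s t j|b g|g h|p k|p|p q k] /=; intuition lia. Qed.

Lemma low_le_trans y x z : low_le x y -> low_le y z -> low_le x z.
Proof.
move=> xy yz; destruct x, y => //; destruct z => //; simpl in *; inv_hyps;
  order_solve.
Qed.

Lemma low_le_anti x y : low_le x y -> low_le y x -> x = y.
Proof.
move=> xy yx; destruct x, y => //; simpl in *; inv_hyps => //; f_equal; lia.
Qed.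

Lemma below_dual_sym x y : below_dual x y -> below_dual y x.
Proof.
by move=> xy; destruct x as [| | |[] ?| | | |], y as [| | |[] ?| | | |] => //;
  simpl in *; inv_hyps; order_solve.
Qed.

Lemma below_dual_le x' x y :
  low_le x' x -> below_dual x y -> below_dual x' y.
Proof.
by move=> xx' xy; destruct x as [| | |[] ?| | | |], y as [| | |[] ?| | | |] => //;
  destruct x' => //; simpl in *; inv_hyps; order_solve.
Qed.

Lemma raw_starK : involutive raw_star.
Proof. by case. Qed.

Lemma raw_star_valid x : raw_valid x -> raw_valid (raw_star x).
Proof. by case: x. Qed.

Lemma raw_le_star x y : raw_le (raw_star y) (raw_star x) <-> raw_le x y.
Proof.
by case: x => [||x|x]; case: y => [||y|y] //=; split; apply: below_dual_sym.
Qed.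

Lemma raw_le_refl x : raw_le x x.
Proof. by case: x => //= x; apply: low_le_refl. Qed.

Lemma raw_le_trans y x z : raw_le x y -> raw_le y z -> raw_le x z.
Proof.
case: x => [||x|x]; case: y => [||y|y] //=; case: z => [||z|z] //=.
- exact: low_le_trans.
- exact: below_dual_le.
- move=> xy zy; apply: below_dual_sym; apply: below_dual_le zy _.
  exact: below_dual_sym.
- by move=> yx zy; apply: low_le_trans zy yx.
Qed.

Lemma raw_le_anti x y : raw_le x y -> raw_le y x -> x = y.
Proof.
case: x => [||x|x]; case: y => [||y|y] //= xy yx; congr (_ _).
- exact: low_le_anti.
- exact: low_le_anti.
Qed.

(** * Absence of 4-crowns *)

Definition comparable_by (T : Type) (le : T -> T -> Prop) (x y : T) : Prop :=
  le x y \/ le y x.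

(** Two blocks share at most one colour, and two gates at most the edge of one inner element. In the
    net two points determine their line, and a colour with one endpoint determines the other
    endpoint, by cancellation in the group. *)
Lemma low_crown x1 x2 y1 y2 :
  low_valid x1 -> low_valid x2 -> low_valid y1 -> low_valid y2 ->
  low_le x1 y1 -> low_le x1 y2 -> low_le x2 y1 -> low_le x2 y2 ->
  comparable_by low_le x1 x2 \/ comparable_by low_le y1 y2.
Proof.
rewrite /comparable_by => vx1 vx2 vy1 vy2 h11 h12 h21 h22.
destruct x1, y1 => //; destruct y2 => //; destruct x2 => //; simpl in *; inv_hyps;
  try (exfalso; eapply wo_lt_asym; eassumption);
  try (exfalso; eapply lt_asymP; eassumption);
  try (exfalso; lia);
  try order_solve;
  try (match goal with |- context [is_true (?m <= ?n)] =>
    case: (leqP m n) => ?; order_solve end).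
all: try (repeat match goal with b : bool |- _ => destruct b end; simpl in *; subst).
all: try order_solve.
all: match goal with H : inl _ = inl _ |- _ => case: H end.
all: by first [move/mulgI-> | move/mulIg/invg_inj->]; right; left.
Qed.

(** What lies in the original copy below a given dual element belongs to a single edge or is a
    single point, so no crown can cross between the copies. *)
Lemma below_dual_crown x1 x2 y :
  below_dual x1 y -> below_dual x2 y -> comparable_by low_le x1 x2.
Proof.
rewrite /comparable_by => h1 h2.
destruct y as [| | |[] ?| | | |] => //; destruct x1 as [| | |[] ?| | | |] => //;
  destruct x2 as [| | |[] ?| | | |] => //; simpl in *; inv_hyps; order_solve ||
  match goal with |- context [is_true (?m <= ?n)] =>
    case: (leqP m n) => ?; order_solve end.
Qed.

Lemma raw_crown x1 x2 y1 y2 :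
  raw_valid x1 -> raw_valid x2 -> raw_valid y1 -> raw_valid y2 ->
  raw_le x1 y1 -> raw_le x1 y2 -> raw_le x2 y1 -> raw_le x2 y2 ->
  comparable_by raw_le x1 x2 \/ comparable_by raw_le y1 y2.
Proof.
rewrite /comparable_by.
case: x1 x2 y1 y2 => [||x1|x1] [||x2|x2] [||y1|y1] [||y2|y2] //=;
  try (by move=> *; do ?[by left; left | by left; right
                        | by right; left | by right; right]).
- exact: low_crown.
- by move=> ? ? ? ? _ h1 _ h2; left; apply: below_dual_crown h1 h2.
- by move=> ? ? ? ? h1 _ h2 _; left; apply: below_dual_crown h1 h2.
- by move=> ? ? ? ? h1 _ h2 _; left; apply: below_dual_crown h1 h2.
- move=> ? ? ? ? h1 h2 _ _; right.
  by apply: (@below_dual_crown _ _ x1); apply: below_dual_sym.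
- move=> ? ? ? ? _ _ h1 h2; right.
  by apply: (@below_dual_crown _ _ x2); apply: below_dual_sym.
- by move=> ? ? ? ? *; case: (@low_crown y1 y2 x1 x2) => //; rewrite /comparable_by;
    tauto.
Qed.

(** Both functions only need to be strictly monotone, with values from 1 to 15 on valid elements. In
    [raw_height] the depth of [x] serves as the height of [Hi x]. *)
Definition low_height (x : low) : nat :=
  match x with
  | Color _ | Tag _ _ _ | Vert _ _ => 1
  | Chain _ _ j => j + 2
  | Edge _ _ => 2
  | Hub _ k => k + 1
  | Link _ => 3
  | Gate _ _ k => k + 2
  end.

Definition low_depth (x : low) : nat :=
  match x with
  | Color _ => 15
  | Chain _ _ j => 14 - j
  | Tag _ _ j => 15 - j
  | Vert _ _ => 2
  | Edge _ _ | Link _ => 1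
  | Hub _ k => 4 - k
  | Gate _ _ k => 3 - k
  end.

Definition raw_height (x : raw) : nat :=
  match x with
  | Bot => 0 | Top => 16 | Lo x => low_height x | Hi x => low_depth x
  end.

Lemma low_height_lt x y : low_valid x -> low_valid y -> low_le x y -> x <> y ->
  low_height x < low_height y /\ low_depth y < low_depth x.
Proof.
move=> vx vy xy nxy; destruct x, y => //; simpl in *; inv_hyps; try done; try lia;
  try (match goal with H : ?x ?n <> ?x ?m |- _ =>
     assert (n <> m) by congruence; lia end).
Qed.

Lemma raw_height_lt x y : raw_valid x -> raw_valid y -> raw_le x y -> x <> y ->
  raw_height x < raw_height y.
Proof.
case: x => [||x|x]; case: y => [||y|y] //= vx vy xy nxy.
- by clear -vy; destruct y; simpl in *; lia.
- by clear -vy; destruct y; simpl in *; lia.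
- by clear -vx; destruct x; simpl in *; lia.
- by apply: (proj1 (low_height_lt vx vy xy _)) => e; apply: nxy; rewrite e.
- by destruct x as [| | |[] ?| | | |], y as [| | |[] ?| | | |] => //;
    simpl in *; lia.
- by clear -vx; destruct x; simpl in *; lia.
- by apply: (proj2 (low_height_lt vy vx xy _)) => e; apply: nxy; rewrite e.
Qed.

End Construction.

(** * The lattice *)

Arguments color {dP} P G.
Arguments low {dP} P G.
Arguments raw {dP} P G.
Arguments Bot {dP P G}.
Arguments Top {dP P G}.
Arguments Color {dP P G}.
Arguments Chain {dP P G}.
Arguments Tag {dP P G}.
Arguments Vert {dP P G}.
Arguments Edge {dP P G}.
Arguments Hub {dP P G}.
Arguments Link {dP P G}.
Arguments Gate {dP P G}.

Section NoCrown.
Local Open Scope order_scope.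

(* Common lower bounds of incomparable elements form a chain, so one of
   greatest height is the greatest. *)
Lemma glb_of_no_crown d (T : porderType d) (bot : T) (height : T -> nat) N :
  (forall x : T, bot <= x) ->
  (forall x y : T, x < y -> (height x < height y)%N) ->
  (forall x, (height x <= N)%N) ->
  (forall x1 x2 y1 y2 : T, x1 <= y1 -> x1 <= y2 -> x2 <= y1 -> x2 <= y2 ->
     x1 >=< x2 \/ y1 >=< y2) ->
  forall x y : T, exists m, forall w, (w <= m) = (w <= x) && (w <= y).
Proof.
move=> bot_le height_lt heightN crown x y.
have [xy|nxy] := boolP (x >=< y).
  by exists (Order.min x y) => w; rewrite comparable_le_min.
pose attained n := `[< exists w, [/\ height w = n, w <= x & w <= y] >].
have attained0 : exists n, attained n.
  by exists (height bot); apply/asboolP; exists bot.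
have attainedN n : attained n -> (n <= N)%N by move=> /asboolP[w [<-]].
case: (ex_maxnP attained0 attainedN) => n /asboolP[m [hm mx my]] nmax.
exists m => w; apply/idP/andP => [wm|[wx wy]].
  by split; apply: le_trans wm _.
have [cmp|cmp] := crown _ _ _ _ wx wy mx my; last by rewrite cmp in nxy.
case: (comparable_ltgtP cmp) => // mw.
have : (height w <= n)%N by apply: nmax; apply/asboolP; exists w.
by rewrite leqNgt -hm height_lt.
Qed.

End NoCrown.

Fact elt_display : Order.disp_t. Proof. exact: Order.Disp tt tt. Qed.

Section Lattice.
Local Open Scope order_scope.
Context {dP : Order.disp_t} (P : tbPOrderType dP) (G : groupType).

Definition elt : Type := {x : raw P G | raw_valid x}.

HB.instance Definition _ := gen_eqMixin elt.
HB.instance Definition _ := gen_choiceMixin elt.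

Lemma elt_inj (x y : elt) : sval x = sval y -> x = y.
Proof. by move=> xy; apply: eq_sig_hprop => // ? ? ?; apply: Prop_irrelevance. Qed.

Definition elt_le : rel elt := fun x y => `[< raw_le (sval x) (sval y) >].

Fact elt_le_refl : reflexive elt_le.
Proof. by move=> x; apply/asboolP/raw_le_refl. Qed.

Fact elt_le_anti : antisymmetric elt_le.
Proof.
by move=> x y /andP[/asboolP xy /asboolP yx]; apply/elt_inj/raw_le_anti.
Qed.

Fact elt_le_trans : transitive elt_le.
Proof.
by move=> y x z /asboolP xy /asboolP yz; apply/asboolP; apply: raw_le_trans xy yz.
Qed.

HB.instance Definition _ := Order.Le_isPOrder.Build elt_display elt
  elt_le_refl elt_le_anti elt_le_trans.

Lemma elt_leP (x y : elt) : reflect (raw_le (sval x) (sval y)) (x <= y).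
Proof. exact: asboolP. Qed.

Definition elt_bot : elt := exist _ Bot I.
Definition elt_top : elt := exist _ Top I.
Definition star (x : elt) : elt :=
  exist _ (raw_star (sval x)) (raw_star_valid (svalP x)).
Definition height (x : elt) : nat := raw_height (sval x).

Lemma elt_bot_le x : elt_bot <= x. Proof. exact/elt_leP. Qed.
Lemma le_elt_top x : x <= elt_top. Proof. by apply/elt_leP; case: x => [[]]. Qed.

Lemma starK : involutive star.
Proof. by move=> x; apply/elt_inj/raw_starK. Qed.

Lemma le_star x y : (star x <= star y) = (y <= x).
Proof. by apply/elt_leP/elt_leP => /raw_le_star. Qed.

Lemma height_lt (x y : elt) : x < y -> (height x < height y)%N.
Proof.
rewrite lt_neqAle => /andP[/eqP nxy /elt_leP xy].
apply: raw_height_lt xy _; [exact: svalP|exact: svalP|].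
by move=> e; apply/nxy/elt_inj.
Qed.

Lemma height_le (x : elt) : (height x <= 16)%N.
Proof.
have [->//|ntop] := eqVneq x elt_top.
by apply/ltnW/(@height_lt x elt_top); rewrite lt_neqAle ntop le_elt_top.
Qed.

Lemma elt_crown (x1 x2 y1 y2 : elt) :
  x1 <= y1 -> x1 <= y2 -> x2 <= y1 -> x2 <= y2 -> x1 >=< x2 \/ y1 >=< y2.
Proof.
move=> /elt_leP h11 /elt_leP h12 /elt_leP h21 /elt_leP h22.
case: (raw_crown (svalP x1) (svalP x2) (svalP y1) (svalP y2) h11 h12 h21 h22)
  => cmp; [left|right];
  by case: cmp => /elt_leP le; rewrite /Order.comparable le ?orbT.
Qed.

Lemma elt_meet_exists (x y : elt) :
  exists m : elt, forall w, (w <= m) = (w <= x) && (w <= y).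
Proof. exact: (glb_of_no_crown elt_bot_le height_lt height_le elt_crown). Qed.

Definition elt_meet (x y : elt) : elt := sval (cid (elt_meet_exists x y)).
(** Going through the duality spares a dual of the crown argument. *)
Definition elt_join (x y : elt) : elt := star (elt_meet (star x) (star y)).

Fact elt_meetP (x y z : elt) : (x <= elt_meet y z) = (x <= y) && (x <= z).
Proof. exact: (svalP (cid (elt_meet_exists y z))). Qed.

Fact elt_joinP (x y z : elt) : (elt_join x y <= z) = (x <= z) && (y <= z).
Proof. by rewrite -[z in LHS]starK le_star elt_meetP !le_star. Qed.

HB.instance Definition _ := Order.POrder_MeetJoin_isLattice.Build elt_display elt
  elt_meetP elt_joinP.

Lemma star_meet (x y : elt) : star (x `&` y) = star x `|` star y.
Proof.
have -> : star x `|` star y = star (elt_meet (star (star x)) (star (star y))) by [].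
by rewrite !starK.
Qed.

Lemma star_join (x y : elt) : star (x `|` y) = star x `&` star y.
Proof. by rewrite -[RHS]starK star_meet !starK. Qed.

Lemma elt_selfdual : selfdual elt.
Proof.
exists star; split; first by exists star; apply: starK.
- exact: star_meet.
- exact: star_join.
Qed.

End Lattice.

(** * Length *)

Section Length.
Local Open Scope order_scope.
Context {dP : Order.disp_t} (P : tbPOrderType dP) (G : groupType).
Local Notation L := (elt P G).

(** A chain through one block, with 1 + 1 + 14 + 1 = 17 elements, whose [n]-th element has height
    [n]. *)
Definition long_chain_raw (s t : color P G) (n : nat) : raw P G :=
  match n with
  | 0 => Bot
  | 1 => Lo (Color t)
  | j.+2 => if (j < 14)%N then Lo (Chain s t j) else Top
  end.

Lemma long_chain_valid s t n : wo_lt s t -> raw_valid (long_chain_raw s t n).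
Proof. by case: n => [|[|j]] //= st; case: ifP. Qed.

Definition long_chain s t (st : wo_lt s t) (n : nat) : L :=
  exist _ (long_chain_raw s t n) (long_chain_valid n st).

Lemma long_chain_homo s t (st : wo_lt s t) :
  {homo long_chain st : m n / (m <= n)%N >-> m <= n}.
Proof.
move=> m n mn; apply/elt_leP => /=; case: m n mn => [|[|i]] [|[|j]] //= ij;
  do ?case: ifP => //=; try order_solve; lia.
Qed.

Lemma height_long_chain s t (st : wo_lt s t) n :
  (n <= 16)%N -> height (long_chain st n) = n.
Proof.
case: n => [|[|j]] // j14; rewrite /height /=.
by case: ifPn => /=; lia.
Qed.

Lemma elt_length (s t : color P G) : wo_lt s t -> has_length L 16.
Proof.
move=> st; split.
- exists (long_chain st @` `I_17); split.
    move=> _ _ [m _ <-] [n _ <-].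
    by case/orP: (leq_total m n) => /(long_chain_homo st); [left|right].
  apply: inj_card_eq => m n /[!inE] m17 n17 mn.
  by rewrite -(height_long_chain st m17) -[RHS](height_long_chain st n17) mn.
- move=> C chainC.
  (* The height is injective on a chain, and its values are at most 16. *)
  have heightC : (@height _ P G @` C #= C)%card.
    apply: inj_card_eq => x y /[!inE] Cx Cy hxy.
    have [->//|nxy] := eqVneq x y.
    have [xy|yx] := chainC x y Cx Cy.
    + have := @height_lt _ _ _ x y.
      by rewrite lt_neqAle nxy xy hxy ltnn => /(_ isT).
    + have := @height_lt _ _ _ y x.
      by rewrite lt_neqAle eq_sym nxy yx hxy ltnn => /(_ isT).
  rewrite -(card_le_eql heightC).
  by apply: subset_card_le => _ [x _ <-]; apply: height_le.
Qed.

End Length.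

(** * Congruences and their kernels *)

Section Congruences.
Local Open Scope order_scope.
Context {d : Order.disp_t} {L : latticeType d}.

Lemma con_congruence (a b : L) : congruence (con a b).
Proof.
split.
- by move=> x T [[]].
- by move=> x y xy T TP; case: (TP) => [[_ sT _ _ _] _];
    apply: sT (xy _ TP).
- by move=> x y z xy yz T TP; case: (TP) => [[_ _ tT _ _] _];
    apply: tT (xy _ TP) (yz _ TP).
- by move=> x1 y1 x2 y2 xy1 xy2 T TP; case: (TP) => [[_ _ _ mT _] _];
    apply: mT (xy1 _ TP) (xy2 _ TP).
- by move=> x1 y1 x2 y2 xy1 xy2 T TP; case: (TP) => [[_ _ _ _ jT] _];
    apply: jT (xy1 _ TP) (xy2 _ TP).
Qed.

Lemma con_gen (a b : L) : con a b (a, b).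
Proof. by move=> T [_]; apply. Qed.

Lemma con_min (a b : L) theta : congruence theta -> theta (a, b) ->
  con a b `<=` theta.
Proof. by move=> ctheta ab x; apply; split=> // _ ->. Qed.

(* A closure operator has a kernel compatible with joins, an interior operator
   one compatible with meets. *)
Lemma congruence_kernel (up down : L -> L) :
  {homo up : x y / x <= y} -> {homo down : x y / x <= y} ->
  (forall x, x <= up x) -> (forall x, down x <= x) ->
  (forall x, up (down x) = up x) -> (forall x, down (up x) = down x) ->
  congruence [set xy | up xy.1 = up xy.2].
Proof.
move=> up_homo down_homo le_up down_le upK downK.
(* Both maps are idempotent because each absorbs the other. *)
have up2 x : up (up x) = up x by rewrite -upK downK upK.
have down2 x : down (down x) = down x by rewrite -downK upK downK.
have upU x y : up (x `|` y) = up (up x `|` up y).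
  apply/le_anti/andP; split; first by apply/up_homo/leU2.
  rewrite -[in leRHS]up2; apply: (up_homo).
  by rewrite leUx !up_homo ?leUl ?leUr.
have downI x y : down (x `&` y) = down (down x `&` down y).
  apply/le_anti/andP; split; last by apply/down_homo/leI2.
  rewrite -[in leLHS]down2; apply: (down_homo).
  by rewrite lexI !down_homo ?leIl ?leIr.
(* The kernel of [up] lies in that of [down], and [upK] gives the converse, so meets can be handled
   through [down]. *)
have downE x y : up x = up y -> down x = down y.
  by move=> xy; rewrite -(downK x) xy downK.
split=> //=.
- by move=> x y z ->.
- by move=> x1 y1 x2 y2 /downE e1 /downE e2; rewrite -upK downI e1 e2 -downI upK.
- by move=> x1 y1 x2 y2 e1 e2; rewrite upU e1 e2 -upU.
Qed.

(** Reduces the study of principal congruences to comparable pairs. *)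
Lemma con_meet_join (x y : L) : con x y = con (x `&` y) (x `|` y).
Proof.
have [rc sc tc mc jc] := con_congruence x y.
have [rm sm tm mm jm] := con_congruence (x `&` y) (x `|` y).
have cxy := @con_gen x y; have cm := @con_gen (x `&` y) (x `|` y).
apply/seteqP; split; apply: con_min; try exact: con_congruence.
- have e1 : con (x `&` y) (x `|` y) (x, x `|` y).
    by have := jm _ _ _ _ (rm x) cm; rewrite meetKU joinA joinxx.
  have e2 : con (x `&` y) (x `|` y) (y, x `|` y).
    by have := jm _ _ _ _ (rm y) cm; rewrite meetC meetKU joinCA joinxx.
  exact: (tm _ _ _ e1 (sm _ _ e2)).
- have e1 : con x y (x `&` y, y) by have := mc _ _ _ _ cxy (rc y); rewrite meetxx.
  have e2 : con x y (y, x `|` y).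
    by have := jc _ _ _ _ cxy (rc y); rewrite joinxx => /(sc _ _).
  exact: (tc _ _ _ e1 e2).
Qed.

End Congruences.

(** * Named elements, and the joins and meets in a gate *)

Section Elements.
Local Open Scope order_scope.
Context {dP : Order.disp_t} {P : tbPOrderType dP} {G : groupType}.
Local Notation L := (elt P G).
Implicit Types (a b c w : raw P G) (x y : low P G) (p q r : P).

(* Invalid raw elements are sent to the least element. *)
Definition el (a : raw P G) : L :=
  match pselect (raw_valid a) with
  | left va => exist _ a va
  | right _ => elt_bot P G
  end.

Lemma sval_el a : raw_valid a -> sval (el a) = a.
Proof. by rewrite /el; case: pselect. Qed.

Lemma el_sval (u : L) : el (sval u) = u.
Proof. by apply/elt_inj/sval_el/svalP. Qed.

Lemma le_el a b : raw_valid a -> raw_valid b ->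
  (el a <= el b) <-> raw_le a b.
Proof.
by move=> va vb; split=> [/elt_leP|ab]; [|apply/elt_leP]; rewrite !sval_el.
Qed.

Lemma star_el a : raw_valid a -> star (el a) = el (raw_star a).
Proof.
by move=> va; apply: elt_inj; rewrite /= !sval_el //; apply: raw_star_valid.
Qed.

Lemma el_Bot : el Bot = elt_bot P G.
Proof. by apply: elt_inj; rewrite sval_el. Qed.

Lemma el_Top : el Top = elt_top P G.
Proof. by apply: elt_inj; rewrite sval_el. Qed.

Lemma join_el a b c : raw_valid a -> raw_valid b -> raw_valid c ->
  raw_le a c -> raw_le b c ->
  (forall w, raw_valid w -> raw_le a w -> raw_le b w -> raw_le c w) ->
  el a `|` el b = el c.
Proof.
move=> va vb vc ac bc cmin; apply/le_anti/andP; split.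
- by rewrite leUx; apply/andP; split; apply/le_el.
- apply/elt_leP; rewrite sval_el //; apply: cmin; first exact: svalP.
  + by rewrite -{1}(sval_el va); apply/elt_leP/leUl.
  + by rewrite -{1}(sval_el vb); apply/elt_leP/leUr.
Qed.

Lemma meet_el a b c : raw_valid a -> raw_valid b -> raw_valid c ->
  raw_le c a -> raw_le c b ->
  (forall w, raw_valid w -> raw_le w a -> raw_le w b -> raw_le w c) ->
  el a `&` el b = el c.
Proof.
move=> va vb vc ca cb cmax; apply/le_anti/andP; split.
- apply/elt_leP; rewrite sval_el //; apply: cmax; first exact: svalP.
  + by rewrite -{2}(sval_el va); apply/elt_leP/leIl.
  + by rewrite -{2}(sval_el vb); apply/elt_leP/leIr.
- by rewrite lexI; apply/andP; split; apply/le_el.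
Qed.

Lemma join_el_le a b : raw_valid a -> raw_valid b -> raw_le a b ->
  el a `|` el b = el b.
Proof. by move=> va vb ab; apply/join_r/le_el. Qed.

Lemma meet_el_le a b : raw_valid a -> raw_valid b -> raw_le a b ->
  el a `&` el b = el a.
Proof. by move=> va vb ab; apply/meet_l/le_el. Qed.

Definition hub p k : L := el (Lo (Hub p k)).
Definition gate p q k : L := el (Lo (Gate p q k)).

Section Gates.
Context (p q : P).
Context (ip : inner p) (iq : inner q) (pq : p < q).

Ltac bound_solve := let w := fresh "w" in
  repeat split => //; try order_solve;
  move=> w vw wa wb; destruct w as [| |w|w] => //; destruct w => //;
  simpl in *; inv_hyps; try order_solve;
  (* Left over are bounds [w] that would force [p = q] or lie in a gate of the reversed pair. *)
  match goal with
  | H : is_true (@Order.lt _ _ ?x ?x) |- _ => case: (lt_asymP H H)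
  | H : is_true (@Order.lt _ _ ?x ?y), H' : is_true (@Order.lt _ _ ?y ?x) |- _ =>
      case: (lt_asymP H H')
  end.

Lemma hub_join00 : hub p 0 `|` hub q 0 = gate p q 0.
Proof. apply: join_el; bound_solve. Qed.

Lemma hub_join10 : hub p 1 `|` hub q 0 = gate p q 1.
Proof. apply: join_el; bound_solve. Qed.

Lemma hub_join01 : hub p 0 `|` hub q 1 = gate p q 2.
Proof. apply: join_el; bound_solve. Qed.

Lemma gate_meet0l : gate p q 0 `&` hub p 1 = hub p 0.
Proof. apply: meet_el; bound_solve. Qed.

Lemma gate_meet0r : gate p q 0 `&` hub q 1 = hub q 0.
Proof. apply: meet_el; bound_solve. Qed.

Lemma gate_meet1r : gate p q 1 `&` hub q 1 = hub q 0.
Proof. apply: meet_el; bound_solve. Qed.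

End Gates.
End Elements.

(** * Principal congruences *)

Section Kernels.
Local Open Scope order_scope.
Context {dP : Order.disp_t} {P : tbPOrderType dP} {G : groupType}.
Local Notation L := (elt P G).
Implicit Types (a b c w : raw P G) (x y : low P G) (p q r : P).

(** [low_up p] and [low_down p] give the greatest and the least element of a class of the congruence
    representing [p]. In a gate from [r] to [s] only a and b are identified when [r <= p] but not
    [s <= p], and all of a < b < i when [s <= p]. *)
Definition low_up p x : low P G :=
  match x with
  | Hub r k => if r <= p then Hub r 1 else x
  | Gate r s k => if s <= p then Gate r s 2
                  else if (r <= p) && (k == 0) then Gate r s 1 else x
  | _ => x
  end.

Definition low_down p x : low P G :=
  match x with
  | Hub r k => if r <= p then Hub r 0 else x
  | Gate r s k => if s <= p then Gate r s 0
                  else if (r <= p) && (k == 1)%N then Gate r s 0 else x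
  | _ => x
  end.

Lemma le_of_lt_le p q r : p < q -> q <= r -> (p <= r) = true.
Proof. by move=> pq qr; rewrite (le_trans (ltW pq) qr). Qed.

Ltac gate_cases p := simpl in *; inv_hyps; try done; try order_solve;
  repeat match goal with
  | H : is_true (?n < 2)%N |- _ => is_var n; destruct n as [|[|n]]; [..|by []]
  | H : is_true (?n < 3)%N |- _ => is_var n; destruct n as [|[|[|n]]]; [..|by []]
  end; try done;
  repeat match goal with
  | H : is_true (@Order.lt _ _ ?r ?s) |- context [?s <= p] =>
      let E := fresh "E" in
      destruct (s <= p) eqn:E; [rewrite ?(le_of_lt_le H E) in * | ]
  | |- context [?r <= p] => let E := fresh "E" in destruct (r <= p) eqn:E
  end; simpl in *;
  repeat match goal with E : (?r <= p) = _ |- context [?r <= p] => rewrite E /= end;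
  try done; try order_solve;
  try match goal with
  | H : is_true (@Order.lt _ _ ?r ?s), E : (?r <= p) = false, F : (?s <= p) = true |- _ =>
      rewrite (le_of_lt_le H F) in E; discriminate E
  end.

Lemma low_up_valid p x : low_valid x -> low_valid (low_up p x).
Proof. by move=> vx; destruct x => //; gate_cases p. Qed.

Lemma low_down_valid p x : low_valid x -> low_valid (low_down p x).
Proof. by move=> vx; destruct x => //; gate_cases p. Qed.

Lemma low_le_up p x : low_valid x -> low_le x (low_up p x).
Proof. by move=> vx; destruct x => //; gate_cases p. Qed.

Lemma low_down_le p x : low_valid x -> low_le (low_down p x) x.
Proof. by move=> vx; destruct x => //; gate_cases p. Qed.

Lemma low_upK p x : low_valid x -> low_up p (low_down p x) = low_up p x.
Proof. by move=> vx; destruct x => //; gate_cases p. Qed.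

Lemma low_downK p x : low_valid x -> low_down p (low_up p x) = low_down p x.
Proof. by move=> vx; destruct x => //; gate_cases p. Qed.

Lemma low_up_homo p x y : low_valid x -> low_valid y -> low_le x y ->
  low_le (low_up p x) (low_up p y).
Proof. by move=> vx vy xy; destruct x, y => //; gate_cases p. Qed.

Lemma low_down_homo p x y : low_valid x -> low_valid y -> low_le x y ->
  low_le (low_down p x) (low_down p y).
Proof. by move=> vx vy xy; destruct x, y => //; gate_cases p. Qed.

(** In the dual copy the top of a class is reached through [low_down]. On the square of an edge the
    claim amounts to 1 + 0 <= 1. *)
Lemma below_dual_up_down p x y : low_valid x -> low_valid y ->
  below_dual x y -> below_dual (low_up p x) (low_down p y).
Proof.
by move=> vx vy xy; destruct x as [| | |[] ?| | | |], y as [| | |[] ?| | | |] => //;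
  gate_cases p.
Qed.

Definition raw_up p a : raw P G :=
  match a with Lo x => Lo (low_up p x) | Hi x => Hi (low_down p x) | _ => a end.

Lemma raw_up_valid p a : raw_valid a -> raw_valid (raw_up p a).
Proof. by case: a => //= x; [apply: low_up_valid|apply: low_down_valid]. Qed.

Lemma raw_le_up p a : raw_valid a -> raw_le a (raw_up p a).
Proof. by case: a => //= x; [apply: low_le_up|apply: low_down_le]. Qed.

Lemma raw_up_homo p a b : raw_valid a -> raw_valid b -> raw_le a b ->
  raw_le (raw_up p a) (raw_up p b).
Proof.
case: a b => [||x|x] [||y|y] //= vx vy.
- exact: low_up_homo.
- exact: below_dual_up_down.
- exact: low_down_homo.
Qed.

Definition elt_up p (u : L) : L :=
  exist _ (raw_up p (sval u)) (raw_up_valid p (svalP u)).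
Definition elt_down p (u : L) : L := star (elt_up p (star u)).

Lemma elt_up_homo p : {homo elt_up p : u v / u <= v}.
Proof.
by move=> u v /elt_leP uv; apply/elt_leP/raw_up_homo => //; apply: svalP.
Qed.

Lemma le_elt_up p u : u <= elt_up p u.
Proof. exact/elt_leP/raw_le_up/svalP. Qed.

Lemma elt_upK p u : elt_up p (elt_down p u) = elt_up p u.
Proof.
by apply: elt_inj; case: u => [[||x|x] vx] //=;
  rewrite ?low_upK ?low_downK //; apply: vx.
Qed.

Definition kernel p : set (L * L) := [set uv | elt_up p uv.1 = elt_up p uv.2].

Lemma kernel_congruence p : congruence (kernel p).
Proof.
apply: (@congruence_kernel _ _ (elt_up p) (elt_down p)).
- exact: elt_up_homo.
- by move=> u v uv; rewrite /elt_down le_star; apply/elt_up_homo; rewrite le_star.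
- exact: le_elt_up.
- by move=> u; rewrite -[leRHS]starK le_star; apply: le_elt_up.
- exact: elt_upK.
- by move=> u; have := elt_upK p (star u); rewrite /elt_down starK => ->.
Qed.

End Kernels.

(** * Consequences of collapsing the edge of an inner element *)

Section CongruenceStructure.
Local Open Scope order_scope.
Context {dP : Order.disp_t} {P : tbPOrderType dP} {G : groupType}.
Local Notation L := (elt P G).
Implicit Types (a b c w : raw P G) (x y : low P G) (p q r : P) (u v : L).
Implicit Types theta : set (L * L).

(** Transfers results about the original copy to the dual one. *)
Lemma congruence_star theta : congruence theta ->
  congruence [set uv | theta (star uv.1, star uv.2)].
Proof.
case=> r s t m j; split=> //=.
- by move=> u v; apply: s.
- by move=> u v w; apply: t.
- by move=> u1 v1 u2 v2 h1 h2; rewrite !star_meet; apply: j.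
- by move=> u1 v1 u2 v2 h1 h2; rewrite !star_join; apply: m.
Qed.

Definition inner_edge theta p := theta (hub p 0, hub p 1).

(** The gate from [r] to [p] transports the collapse: joining with a_r identifies the two ends of
    the gate, and meeting with b_r then gives the edge of [r]. *)
Lemma inner_edge_le theta p r : congruence theta -> inner p -> inner r ->
  r <= p -> inner_edge theta p -> inner_edge theta r.
Proof.
move=> [re _ _ m j] ip ir rp edge.
have [->//|nrp] := eqVneq r p.
have {nrp} lt_rp : r < p by rewrite lt_neqAle nrp.
have := j _ _ _ _ (re (hub r 0)) edge.
rewrite hub_join00 // hub_join01 // => gates.
have := m _ _ _ _ gates (re (hub r 1)).
rewrite gate_meet0l // /gate [el (Lo (Gate r p 2)) `&` _]meetC meet_el_le //.
by left.
Qed.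

Lemma congruence_low_up theta p x : congruence theta -> inner p ->
  inner_edge theta p -> low_valid x ->
  theta (el (Lo x), el (Lo (low_up p x))).
Proof.
move=> ctheta ip edge vx; have [re _ _ m j] := ctheta.
destruct x as [s|s t i|s t i|b g|g h|r k|r|r s k] => //=.
- case: ifP => // rp; case: vx => ir k2.
  have edger := inner_edge_le ctheta ip ir rp edge.
  by case: k k2 => [|[|k]].
- case: vx => ir [js [rs k3]].
  have jgate i l : (i < 3)%N -> (i <= l < 3)%N ->
      el (Lo (Gate r s i)) `|` el (Lo (Gate r s l)) = el (Lo (Gate r s l)).
    by move=> ? ?; apply: join_el_le => /=; order_solve.
  case: ifP => [sp|nsp].
    have edges := inner_edge_le ctheta ip js sp edge.
    have := j _ _ _ _ (re (hub r 0)) edges.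
    rewrite hub_join00 // hub_join01 // => gates.
    (* The ends of the gate are congruent; joining with the element of index [k] raises the lower
       end to it and leaves the upper end in place. *)
    have := j _ _ _ _ gates (re (gate r s k)).
    by rewrite jgate // joinC jgate //; lia.
  case: ifP => // /andP[rp /eqP->].
  have edger := inner_edge_le ctheta ip ir rp edge.
  have := j _ _ _ _ edger (re (hub s 0)).
  by rewrite hub_join00 // hub_join10.
Qed.

End CongruenceStructure.

(** * Classification of the principal congruences *)

Section PrincipalCongruences.
Local Open Scope order_scope.
Context {dP : Order.disp_t} {P : tbPOrderType dP} {G : groupType}.
Context (P_nontrivial : (\bot : P) <> \top).
Local Notation L := (elt P G).
Implicit Types (a b c w : raw P G) (x y : low P G) (p q r : P) (u v : L).
Implicit Types theta : set (L * L).

(** The unit of [G] and the two bounds of [P] are three distinct colours, so two colours other than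
    [s] exist; [s] forms a block with each, in whichever order the well-order puts them. *)
Lemma two_blocks (s : color P G) : exists a b a' b' : color P G,
  [/\ wo_lt a b, wo_lt a' b', (a, b) <> (a', b'), s = a \/ s = b
    & s = a' \/ s = b'].
Proof.
have [t [u [st su tu]]] : exists t u : color P G, [/\ s <> t, s <> u & t <> u].
  have [->|s1] := pselect (s = inl 1%g).
    by exists (inr \bot), (inr \top); split=> // -[].
  have [->|s2] := pselect (s = inr \bot).
    by exists (inl 1%g), (inr \top); split=> // -[].
  by exists (inl 1%g), (inr \bot).
have block (c : color P G) : s <> c -> exists a b : color P G,
    [/\ wo_lt a b, s = a \/ s = b, c = a \/ c = b & forall e, e = a \/ e = b -> e = s \/ e = c].
  move=> sc; case: (wo_lt_total sc) => lt_sc; [exists s, c|exists c, s];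
    by split; tauto.
have [a [b [ab sab tab abE]]] := block t st.
have [a' [b' [ab' sab' uab' _]]] := block u su.
exists a, b, a', b'; split=> // -[ea eb]; subst a' b'.
by case: (abE _ uab') => /esym.
Qed.

(** In the square of an edge and its dual, joining with [Hi (Hub p 1)] carries one to the other. *)
Lemma inner_edge_star theta p : congruence theta -> inner p ->
  inner_edge theta p -> theta (star (hub p 0), star (hub p 1)).
Proof.
case=> re s _ _ j ip edge; apply: s.
have := j _ _ _ _ edge (re (el (Hi (Hub p 1)))).
have -> : hub p 0 `|` el (Hi (Hub p 1)) = star (hub p 1) :> L.
  by rewrite /hub star_el //; apply: join_el_le.
suff -> : hub p 1 `|` el (Hi (Hub p 1)) = star (hub p 0) :> L by [].
rewrite /hub star_el //; apply: join_el => //.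
by case=> [||w|w] //=; case: w => // r k /= *; inv_hyps; order_solve.
Qed.

(** In the original copy each element is congruent to the greatest of its class, and in the dual
    copy, by duality, to the least. *)
Lemma kernel_subset theta p : congruence theta -> inner p ->
  inner_edge theta p -> kernel p `<=` theta.
Proof.
move=> ctheta ip edge [u v]; rewrite /kernel /= => uv.
have cstar := congruence_star ctheta.
have edge_star := inner_edge_star ctheta ip edge.
have [re sym tr _ _] := ctheta.
have lo x : low_valid x -> theta (el (Lo x), el (Lo (low_up p x))).
  exact: congruence_low_up ctheta ip edge.
have hi x : low_valid x -> theta (el (Hi x), el (Hi (low_up p x))).
  move=> vx; have := congruence_low_up cstar ip edge_star vx.
  by rewrite /= !star_el //; apply: low_up_valid.
have {uv} := congr1 sval uv.
rewrite /= -[in theta _](el_sval u) -[in theta _](el_sval v).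
have vu := svalP u; have vv := svalP v.
case: (sval u) (sval v) vu vv => [||x|x] [||y|y] //= vx vy; try exact: re.
- move=> -[xy]; apply: tr (lo _ vx) _; rewrite xy; apply: sym; exact: lo.
- move=> -[xy]; apply: tr (hi _ vx) _; rewrite -low_upK // xy low_upK //.
  by apply: sym; apply: hi.
Qed.

Lemma total_of_bot_top theta : congruence theta ->
  theta (el Bot, el Top) -> theta = [set: L * L].
Proof.
case=> re s t m _ bt; apply/seteqP; split=> // -[u v] _.
have down u' : theta (el Bot, u').
  have := m _ _ _ _ bt (re u').
  by rewrite el_Bot el_Top (meet_l (elt_bot_le u')) (meet_r (le_elt_top u')).
by apply: t (s _ _ (down u)) (down v).
Qed.

(** Two elements with meet 0 are chosen such that each has join 1 with [u]. Both become congruent to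
    1, hence so does their meet. *)
Lemma total_of_bot theta u : congruence theta -> u <> el Bot ->
  theta (el Bot, u) -> theta = [set: L * L].
Proof.
move=> ctheta nu bu; apply: total_of_bot_top => //.
have [re _ _ m j] := ctheta.
have complement w : raw_valid w -> el w `|` u = el Top -> theta (el w, el Top).
  move=> vw wu; have := j _ _ _ _ (re (el w)) bu.
  by rewrite wu el_Bot joinC (join_r (elt_bot_le _)).
have two w w' : raw_valid w -> raw_valid w' -> el w `|` u = el Top ->
    el w' `|` u = el Top -> el w `&` el w' = el Bot -> theta (el Bot, el Top).
  move=> vw vw' /(complement _ vw) h /(complement _ vw') h' ww'.
  by have := m _ _ _ _ h h'; rewrite ww' meetxx.
have [a [b [a' [b' [ab ab' nab _ _]]]]] := two_blocks (inl 1%g).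
have vt : raw_valid (Lo (Tag a b 0) : raw P G) by [].
have vt' : raw_valid (Lo (Tag a' b' 0) : raw P G) by [].
rewrite -(el_sval u) in bu nu two; clear complement.
case: (sval u) (svalP u) bu nu two => [||x|x] //= vx bu nu two.
(* Tags and their duals are unrelated to the copy opposite to them, which gives the joins; taking
   the two tags from distinct blocks gives the meet. *)
- apply: (two (Hi (Tag a b 0)) (Hi (Tag a' b' 0))) => //.
  + apply: join_el => //; case=> [||w|w] //= vw tw xw.
    by destruct w => //; destruct x as [| | |[] ?| | | |].
  + apply: join_el => //; case=> [||w|w] //= vw tw xw.
    by destruct w => //; destruct x as [| | |[] ?| | | |].
  + apply: meet_el => //; case=> [||w|w] //= vw tw tw'.
    * by destruct w as [| | |[] ?| | | |].
    * by destruct w => //; simpl in *; inv_hyps; case: nab.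
- apply: (two (Lo (Tag a b 0)) (Lo (Tag a' b' 0))) => //.
  + apply: join_el => //; case=> [||w|w] //= vw tw xw.
  + apply: join_el => //; case=> [||w|w] //= vw tw xw.
  + apply: meet_el => //; case=> [||w|w] //= vw tw tw'.
    by destruct w => //; simpl in *; inv_hyps; case: nab.
Qed.

Lemma total_of_top theta u : congruence theta -> u <> el Top ->
  theta (u, el Top) -> theta = [set: L * L].
Proof.
move=> ctheta nu ut; have cstar := congruence_star ctheta.
have [_ s _ _ _] := ctheta.
have := @total_of_bot _ (star u) cstar.
rewrite /= starK star_el //= => tot.
have {tot} : [set uv | theta (star uv.1, star uv.2)] = [set: L * L].
  apply: tot; last exact: s.
  by move=> e; apply: nu; rewrite -[u]starK e star_el.
move=> tot; apply/seteqP; split=> // -[v w] _.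
by have := I; rewrite -[True]/([set: L * L] (star v, star w)) -tot /= !starK.
Qed.

(* Here z is disjoint from x, so that theta collapses z with the bottom. *)
Lemma total_of_disjoint theta (x y z : L) : congruence theta -> theta (x, y) ->
  z <= y -> z <> el Bot -> (forall w : L, w <= z -> w <= x -> w = el Bot) ->
  theta = [set: L * L].
Proof.
move=> ctheta xy zy nz disj; have [re _ _ m _] := ctheta.
apply: (total_of_bot ctheta nz).
have := m _ _ _ _ (re z) xy; rewrite (meet_l zy).
by rewrite (disj (z `&` x)) ?leIl ?leIr.
Qed.

Definition atom a : Prop :=
  a <> Bot /\ forall w, raw_valid w -> raw_le w a -> w = Bot \/ w = a.

Lemma total_of_atom theta a b z : congruence theta ->
  raw_valid a -> raw_valid b -> raw_valid z -> theta (el a, el b) ->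
  atom z -> raw_le z b -> ~ raw_le z a -> theta = [set: L * L].
Proof.
move=> ctheta va vb vz ab [z0 zmin] zb za.
apply: (@total_of_disjoint _ (el a) (el b) (el z)) => //; first exact/le_el.
  by move=> /(congr1 sval); rewrite !sval_el.
move=> w /elt_leP wz /elt_leP wa; rewrite !sval_el // in wz wa.
case: (zmin _ (svalP w) wz) => e; first by rewrite -e el_sval.
by case: za; rewrite -e.
Qed.

Lemma atom_color s : atom (Lo (Color s)).
Proof.
split=> // -[||w|w] //= vw; first by left.
  by right; destruct w => //; simpl in *; congr (Lo (Color _)).
Qed.

Lemma atom_tag s t j : atom (Lo (Tag s t j)).
Proof.
split=> // -[||w|w] //= vw; first by left.
by right; destruct w => //; simpl in *; inv_hyps.
Qed.

Lemma atom_vert (b : bool) g : atom (Lo (Vert b g)).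
Proof.
split=> // -[||w|w] //= vw; first by left.
by right; destruct w => //; simpl in *; inv_hyps.
Qed.

Lemma atom_hub p : atom (Lo (Hub p 0)).
Proof.
split=> // -[||w|w] //= vw; first by left.
right; destruct w => //; simpl in *; inv_hyps; congr (Lo (Hub _ _)); lia.
Qed.

Lemma atom_edge g h : atom (Hi (Edge g h)).
Proof.
split=> // -[||w|w] //= vw; first by left.
  by destruct w as [| | |[] ?| | | |].
by right; destruct w => //; simpl in *; inv_hyps.
Qed.

Lemma atom_link p : atom (Hi (Link p)).
Proof.
split=> // -[||w|w] //= vw; first by left.
  by destruct w as [| | |[] ?| | | |].
by right; destruct w => //; simpl in *; inv_hyps.
Qed.

(** Only edges and gates escape separation by an atom; in a gate, meeting with a suitable [Hub r 1]
    leads back to an edge. *)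
Lemma collapse_low theta x y : congruence theta ->
  low_valid x -> low_valid y -> low_le x y -> x <> y ->
  theta (el (Lo x), el (Lo y)) ->
  theta = [set: L * L] \/
  exists p, [/\ inner p, inner_edge theta p & low_up p x = low_up p y].
Proof.
move=> ctheta vx vy xy nxy txy; have [re sy tr m _] := ctheta.
have tot z : low_valid z -> atom (Lo z) -> low_le z y -> ~ low_le z x ->
    theta = [set: L * L] \/
    exists p, [/\ inner p, inner_edge theta p & low_up p x = low_up p y].
  by move=> vz az zy zx; left; apply: (total_of_atom ctheta _ _ _ txy az).
have met r : inner r ->
    theta (el (Lo x) `&` hub r 1, el (Lo y) `&` hub r 1).
  by move=> ir; apply: m.
destruct x as [s|s t j|s t j|b g|g h|p k|p|p q k],
  y as [s'|s' t' j'|s' t' j'|b' g'|g' h'|p' k'|p'|p' q' k'] => //;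
  simpl in xy, vx, vy.
- by case: nxy; rewrite xy.
- apply: (tot (Tag s' t' 0)) => //=; [by inv_hyps|exact: atom_tag].
- by apply: (tot (Vert false g')) => //; apply: atom_vert.
- apply: (tot (Hub p' 0)) => //; apply: atom_hub.
(* The tag of index [j'] separates the two elements, except that there is no tag of index 13, where
   the colour [s'] takes its place. *)
- inv_hyps; have [j'13|j'13] := ltnP j' 13.
    have ? : j <> j' by congruence.
    apply: (tot (Tag s' t' j')) => //=; [exact: atom_tag|lia].
  apply: (tot (Color s')) => //=; [exact: atom_color|by right|].
  have ? : j <> j' by congruence.
  move=> [e|[_ ?]]; last lia.
  by subst t'; match goal with H : wo_lt s' s' |- _ => case: H => _; apply end.
- apply: (tot (Color t')) => //=; [exact: atom_color|by left].
- by inv_hyps; case: nxy.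
- by inv_hyps; case: nxy.
- apply: (tot (Vert (~~ b) (if b then g' else h'))) => //=.
  + exact: atom_vert.
  + by case: (b).
  + by case=> e; case: (b) e.
- by inv_hyps; case: nxy.
- inv_hyps; have ? : k <> k' by congruence.
  have [? ?] : k = 0%N /\ k' = 1%N by lia.
  by subst k k'; right; exists p'; split=> //=; rewrite lexx.
- subst p'; apply: (tot (Color (inr p))) => //=; exact: atom_color.
- inv_hyps.
  + apply: (tot (Hub q' 0)) => /=; [by split|exact: atom_hub|by right|].
    by case=> e _; subst q'; match goal with H : is_true (_ < _)%O |- _ =>
      rewrite ltxx in H end.
  + apply: (tot (Hub p' 0)) => /=; [by split|exact: atom_hub|by left|].
    by case=> e _; subst p'; match goal with H : is_true (_ < _)%O |- _ =>
      rewrite ltxx in H end.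
- by case: nxy; rewrite xy.
- inv_hyps; have ? : k <> k' by congruence.
  have [k'2|k'2] := ltnP k' 2.
    have [? ?] : k = 0%N /\ k' = 1%N by lia.
    subst k k'; right; exists p'; split=> //; last first.
      have lt_pq : p' < q' by [].
      by rewrite /= lexx (lt_geF lt_pq).
    (* Meeting a and b with b_p gives a_p and b_p. *)
    have := met p'; rewrite /inner_edge -/(gate p' q' 0) gate_meet0l //.
    by rewrite [el (Lo (Gate p' q' 1)) `&` _]meetC meet_el_le //=; [apply|left].
  (* The top i of the gate lies above b_q, while a and b both meet b_q in a_q, so it is the edge of
     [q'] that collapses. *)
  have ? : k' = 2 by lia.
  subst k'; right; exists q'; split=> //; last by rewrite /= lexx.
  have gate2 : el (Lo (Gate p' q' 2)) `&` hub q' 1 = hub q' 1 :> L.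
    by rewrite meetC; apply: meet_el_le => //=; right.
  have := met q'; rewrite gate2.
  have [? | ?] : k = 0%N \/ k = 1%N by lia.
    by subst k; rewrite -/(gate p' q' 0) gate_meet0r //; apply.
  by subst k; rewrite -/(gate p' q' 1) gate_meet1r //; apply.
Qed.

Lemma collapse_raw theta a b : congruence theta ->
  raw_valid a -> raw_valid b -> raw_le a b -> a <> b ->
  theta (el a, el b) ->
  theta = [set: L * L] \/
  exists p, [/\ inner p, inner_edge theta p & raw_up p a = raw_up p b].
Proof.
move=> ctheta; case: a b => [||x|x] [||y|y] //= vx vy xy nxy txy.
- by left; apply: (total_of_bot ctheta _ txy) => /(congr1 sval); rewrite !sval_el.
- by left; apply: (total_of_bot ctheta _ txy) => /(congr1 sval); rewrite !sval_el.
- by left; apply: (total_of_bot ctheta _ txy) => /(congr1 sval); rewrite !sval_el.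
- by left; apply: (total_of_top ctheta _ txy) => /(congr1 sval); rewrite !sval_el.
- have [|tot|[p [ip ep e]]] := collapse_low ctheta vx vy xy _ txy; [congruence|by left|].
  by right; exists p; rewrite e.
- have tot z : raw_valid z -> atom z -> raw_le z (Hi y) -> ~ raw_le z (Lo x) ->
      theta = [set: L * L].
    by move=> vz az; apply: (total_of_atom ctheta _ _ vz txy az).
  (* Between the copies the separating atom is the dual of a line through the point, or of the link
     of the edge. *)
  left; destruct x as [| | |[] g| |p k| |], y as [| | |[] h| |q l| |] => //.
    by apply: (tot (Hi (Edge g g))) => //=; apply: atom_edge.
  case: vx => ip _; case: vy => iq _.
  by case: xy => pq _; apply: (tot (Hi (Link q))) => //=; apply: atom_link.
- by left; apply: (total_of_top ctheta _ txy) => /(congr1 sval); rewrite !sval_el.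
- have [_ sym _ _ _] := ctheta; have cstar := congruence_star ctheta.
  have := @collapse_low _ y x cstar vy vx xy.
  rewrite /= !star_el //= => cases.
  have [||tot|[p [ip ep e]]] := cases; [congruence|exact: sym| |].
    left; apply/seteqP; split=> // -[u v] _.
    by have := I; rewrite -[True]/([set: L * L] (star u, star v)) -tot /= !starK.
  right; exists p; split=> //.
    by have := inner_edge_star cstar ip ep; rewrite /= !starK.
  by congr (Hi _); rewrite -(low_downK p vx) -e low_downK.
Qed.

Lemma collapse theta u v : congruence theta -> u < v -> theta (u, v) ->
  theta = [set: L * L] \/
  exists p, [/\ inner p, inner_edge theta p & kernel p (u, v)].
Proof.
move=> ctheta; rewrite lt_neqAle => /andP[/eqP nuv /elt_leP uv] tuv.
have := @collapse_raw theta _ _ ctheta (svalP u) (svalP v) uv.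
rewrite !el_sval => -[||tot|[p [ip ep e]]]; [|exact: tuv|by left|].
  by move=> /elt_inj.
by right; exists p; split=> //; apply: elt_inj.
Qed.

(* The principal congruence representing p; nothing is collapsed when p is the
   least element, as inner elements are never below it. *)
Definition princ_of p : set (L * L) :=
  if p == \top then [set: L * L] else kernel p.

Lemma kernel_bot : kernel (\bot : P) = [set uv : L * L | uv.1 = uv.2].
Proof.
have nle r : inner r -> (r <= \bot) = false.
  by case=> r0 _; rewrite lex0; apply/eqP.
have low_bot x : low_valid x ->
    low_up (\bot : P) x = x /\ low_down (\bot : P) x = x.
  by case: x => //= [p k [ip _]|p q k [ip [iq _]]]; rewrite !nle.
have up_bot u : elt_up (\bot : P) u = u.
  apply: elt_inj; rewrite /=; case: (sval u) (svalP u) => //= x vx;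
    by have [ex ex'] := low_bot x vx; rewrite ?ex ?ex'.
by apply/seteqP; split=> -[u v]; rewrite /kernel /= !up_bot.
Qed.

Lemma kernel_edge p q : inner p -> inner_edge (kernel q : set (L * L)) p <-> p <= q.
Proof.
move=> ip; rewrite /inner_edge /kernel /=; split.
  move=> /(congr1 sval); rewrite /= !sval_el //=.
  by case: ifP.
by move=> pq; apply: elt_inj; rewrite /= !sval_el //= pq.
Qed.

Lemma con_edge p : inner p -> con (hub p 0) (hub p 1) = kernel p :> set (L * L).
Proof.
move=> ip; apply/seteqP; split.
  by apply: con_min; [apply: kernel_congruence|apply/(kernel_edge _ ip)].
by apply: kernel_subset => //; [apply: con_congruence|apply: con_gen].
Qed.

Lemma kernel_nontotal p : ~ kernel p (el Bot : L, el Top : L).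
Proof. by rewrite /kernel /= => /(congr1 sval); rewrite /= !sval_el. Qed.

Lemma inner_cases p : [\/ p = \bot, p = \top | inner p].
Proof.
have [->|/eqP nb] := eqVneq p \bot; first by constructor 1.
have [->|/eqP nt] := eqVneq p \top; first by constructor 2.
by constructor 3.
Qed.

Lemma princ_of_le p q : p <= q <-> princ_of p `<=` princ_of q.
Proof.
rewrite /princ_of; have [->|/eqP nq] := eqVneq q \top.
  by rewrite lex1; split.
case: eqP => [->|np]; split.
- by rewrite le1x => /eqP.
- by move=> /(_ (el Bot, el Top) I) /kernel_nontotal.
- case: (inner_cases p) => // [->|ip] pq.
    rewrite kernel_bot => -[u v] /= ->; exact: (congruence_refl (kernel_congruence q)).
  apply: kernel_subset => //; first exact: kernel_congruence.
  exact/(kernel_edge _ ip).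
- case: (inner_cases p) => // [->|ip] pq; first by rewrite le0x.
  apply/(kernel_edge _ ip)/pq/(kernel_edge _ ip); exact: lexx.
Qed.

Lemma elt_princ : order_isomorphic_Princ L P.
Proof.
exists princ_of; split; last exact: princ_of_le.
split.
- move=> p _ /=; rewrite /princ_of.
  case: eqP => [_|np].
    exists (el Bot), (el Top); apply/esym/total_of_bot_top; first exact: con_congruence.
    exact: con_gen.
  case: (inner_cases p) => // [->|ip]; last first.
    by exists (hub p 0), (hub p 1); rewrite con_edge.
  exists (el Bot), (el Bot); apply/seteqP; split.
    rewrite kernel_bot => -[u v] /= ->; exact: (congruence_refl (con_congruence _ _)).
  by apply: con_min; [apply: kernel_congruence|].
- move=> p q _ _ pq; apply/le_anti/andP.
  by split; apply/princ_of_le; rewrite pq.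
- move=> _ [u [v ->]]; rewrite con_meet_join.
  set m := u `&` v; set j := u `|` v.
  have mj : m <= j by apply: le_trans (leIl _ _) (leUl _ _).
  have [mjE|nmj] := eqVneq m j.
    exists \bot => //; rewrite /princ_of ifF; last by apply/eqP.
    rewrite mjE kernel_bot; apply/seteqP; split.
      by move=> -[u' v'] /= ->; exact: (congruence_refl (con_congruence _ _)).
    by rewrite -kernel_bot; apply: con_min; [apply: kernel_congruence|].
  have ltmj : m < j by rewrite lt_neqAle nmj.
  (* In the second case the generated congruence contains the edge of [p], and its generating pair
     lies in the kernel of [p]; this gives the two inclusions. *)
  have [->|[p [ip ep kp]]] := collapse (con_congruence m j) ltmj (@con_gen _ _ m j).
    by exists \top => //; rewrite /princ_of eqxx.
  exists p => //; rewrite /princ_of ifF; last by apply/eqP; case: ip.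
  apply/seteqP; split.
    by apply: kernel_subset => //; apply: con_congruence.
  by apply: con_min => //; apply: kernel_congruence.
Qed.

End PrincipalCongruences.

(** * Automorphisms *)

Section Automorphisms.
Context {dP : Order.disp_t} {P : tbPOrderType dP} {G : groupType}.
Context (P_nontrivial : (\bot%O : P) <> \top%O).
Local Notation raw := (raw P G).
Implicit Types (a b w z n : raw) (x y : low P G) (p q r : P).
Implicit Types (s t : color P G) (F : raw -> raw).

(** Automorphisms are handled as mutually inverse monotone maps on raw elements, where case analysis
    is direct; values at invalid elements are unconstrained. *)
Definition raw_auto F F' : Prop :=
  [/\ forall a, raw_valid a -> raw_valid (F a) /\ raw_valid (F' a),
      forall a, raw_valid a -> F' (F a) = a /\ F (F' a) = a,
      forall a b, raw_valid a -> raw_valid b -> raw_le a b -> raw_le (F a) (F b)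
    & forall a b, raw_valid a -> raw_valid b -> raw_le a b ->
        raw_le (F' a) (F' b)].

Lemma raw_auto_sym F F' : raw_auto F F' -> raw_auto F' F.
Proof. by case=> v k m m'; split=> // a va; [case: (v a va)|case: (k a va)]. Qed.

Lemma raw_auto_star F F' : raw_auto F F' ->
  raw_auto (raw_star \o F \o raw_star) (raw_star \o F' \o raw_star).
Proof.
case=> v k m m'; split=> /=.
- by move=> a /raw_star_valid/v[? ?]; split; apply: raw_star_valid.
- by move=> a /raw_star_valid/k[h h']; rewrite !raw_starK h h' raw_starK.
- move=> a b va vb ab; apply/raw_le_star; apply: m; try exact: raw_star_valid.
  exact/raw_le_star.
- move=> a b va vb ab; apply/raw_le_star; apply: m'; try exact: raw_star_valid.
  exact/raw_le_star.
Qed.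

Section OneAutomorphism.
Context {F F' : raw -> raw} (FF' : raw_auto F F').

Lemma auto_valid a : raw_valid a -> raw_valid (F a).
Proof. by case: FF' => v _ _ _ /v[]. Qed.

Lemma autoK a : raw_valid a -> F' (F a) = a.
Proof. by case: FF' => _ k _ _ /k[]. Qed.

Lemma auto_inj a b : raw_valid a -> raw_valid b -> F a = F b -> a = b.
Proof. by move=> va vb e; rewrite -(autoK va) e autoK. Qed.

Lemma auto_le a b : raw_valid a -> raw_valid b ->
  raw_le (F a) (F b) <-> raw_le a b.
Proof.
case: FF' => v k m m' va vb; split; last exact: m.
move=> /m'; rewrite !autoK //; apply; exact: auto_valid.
Qed.

Lemma auto_bot : F Bot = Bot.
Proof.
case: FF' => v k m m'; apply: raw_le_anti => //.
have {2}<- : F (F' Bot) = Bot by case: (k Bot I).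
by apply: m => //; case: (v Bot I).
Qed.

Lemma auto_top : F Top = Top.
Proof.
case: FF' => v k m m'; apply: raw_le_anti; first by case: (F Top).
have {1}<- : F (F' Top) = Top by case: (k Top I).
by apply: m => //; [case: (v Top I)|case: (F' Top)].
Qed.

Lemma auto_eq_bot a : raw_valid a -> F a = Bot -> a = Bot.
Proof. by move=> va; rewrite -[in X in _ = X -> _]auto_bot; apply: auto_inj. Qed.

Lemma auto_eq_top a : raw_valid a -> F a = Top -> a = Top.
Proof. by move=> va; rewrite -[in X in _ = X -> _]auto_top; apply: auto_inj. Qed.

End OneAutomorphism.

(* The long chains above this element single out the Chain elements: the
   elements of comparable depth in the dual half are join-irreducible. *)
Definition base n : Prop :=
  (exists u v, [/\ raw_valid u, raw_valid v, raw_le u n, raw_le v n &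
     ~ comparable_by raw_le u v]) /\
  (exists h : nat -> raw, [/\ forall i, i <= 6 -> raw_valid (h i), raw_le n (h 0) &
     forall i, i < 6 -> raw_le (h i) (h i.+1) /\ h i <> h i.+1]).

Lemma base_auto F F' n : raw_auto F F' -> raw_valid n -> base n -> base (F n).
Proof.
move=> FF' vn [[u [v [vu vv un vv' nuv]]] [h [vh nh hh]]].
have v6 i : i < 6 -> raw_valid (h i) /\ raw_valid (h i.+1).
  by move=> i6; split; apply: vh; lia.
split.
  exists (F u), (F v); split; try exact: (auto_valid FF').
  - exact/(auto_le FF').
  - exact/(auto_le FF').
  - by case=> /(auto_le FF') uv; apply: nuv; [left|right]; apply: uv.
exists (F \o h); split=> /=.
- by move=> i i6; apply: (auto_valid FF'); apply: vh.
- by apply/(auto_le FF') => //; apply: vh.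
- move=> i i6; have [vi vi'] := v6 i i6; have [le ne] := hh i i6; split.
    exact/(auto_le FF').
  by move=> /(auto_inj FF' vi vi').
Qed.

(** The height of the dual measures the room above an element: it drops at each of the six strict
    steps of [h]. *)
Lemma base_depth n : raw_valid n -> base n -> 6 <= raw_height (raw_star n).
Proof.
move=> vn [_ [h [vh nh hh]]].
have depth i : i <= 6 ->
    raw_height (raw_star (h i)) + i <= raw_height (raw_star (h 0)).
  elim: i => [|i IHi] i6; first by rewrite addn0.
  have [le ne] := hh i i6.
  have : raw_height (raw_star (h i.+1)) < raw_height (raw_star (h i)).
    apply: raw_height_lt; try (by apply/raw_star_valid/vh; lia).
      exact/raw_le_star.
    by move=> e; apply: ne; rewrite -(raw_starK (h i)) -e raw_starK.
  by have := IHi (ltnW i6); lia.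
have : raw_height (raw_star (h 0)) <= raw_height (raw_star n).
  have [->//|nn] := pselect (h 0 = n).
  apply/ltnW/raw_height_lt; try (by apply/raw_star_valid => //; apply: vh).
    exact/raw_le_star.
  by move=> e; apply: nn; rewrite -(raw_starK (h 0)) e raw_starK.
by have := depth 6 isT; lia.
Qed.

(** Apart from the [Chain] elements, only 0, atoms and elements of dual chains have enough room
    above them, and their lower bounds are linearly ordered. *)
Lemma base_chain n : raw_valid n -> base n ->
  exists s t j, n = Lo (Chain s t j).
Proof.
move=> vn bn; have := base_depth vn bn.
case: bn => [[u [v [vu vv un vn' nuv]]] _].
case: n vn un vn' => [||x|x] vx ux vx' //.
- by case: nuv; destruct u => //; left.
- destruct x as [s|s t j|s t j|b g|g h|p k|p|p q k] => /=; try lia.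
  + case: nuv; rewrite /comparable_by.
    destruct u as [| |[]|], v as [| |[]|] => //; simpl in *; inv_hyps; tauto.
  + by move=> _; do 3 eexists.
  + case: nuv; rewrite /comparable_by.
    destruct u as [| |[]|], v as [| |[]|] => //; simpl in *; inv_hyps; tauto.
- destruct x as [s|s t j|s t j|b g|g h|p k|p|p q k] => /=; try lia;
    [|by move=> h; exfalso; simpl in *; inv_hyps; lia..].
  case: nuv; rewrite /comparable_by.
  destruct u as [| |[| | |[]| | | |]|[]], v as [| |[| | |[]| | | |]|[]] => //;
    simpl in *; inv_hyps; try tauto.
  by case: (leqP n n0) => ?; order_solve.
Qed.

Lemma chain_base s t : wo_lt s t -> base (Lo (Chain s t 0)).
Proof.
move=> st; split.
  exists (Lo (Color t)), (Lo (Tag s t 0)); split=> //=; first by left.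
  by case.
exists (fun i => Lo (Chain s t i)); split=> [i i6|//|i i6] /=; first by split=> //; lia.
by split; [order_solve|case; lia].
Qed.

(** Colours are the nonzero elements lying below members of two distinct blocks; blocks are
    recognised as distinct when bases in them have only 1 as a common upper bound. *)
Definition is_color a : Prop := a <> Bot /\
  exists n1 n2 z1 z2,
    [/\ raw_valid n1, raw_valid n2, raw_valid z1 & raw_valid z2] /\
    [/\ base n1, base n2, raw_le n1 z1, raw_le n2 z2 & z1 <> Top] /\
    [/\ z2 <> Top, raw_le a z1, raw_le a z2 &
      forall w, raw_valid w -> raw_le n1 w -> raw_le n2 w -> w = Top].

Lemma is_colorP a : raw_valid a -> is_color a <-> exists s, a = Lo (Color s).
Proof.
move=> va; split.
  move=> [a0 [n1 [n2 [z1 [z2 [[vn1 vn2 vz1 vz2]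
    [[bn1 bn2 nz1 nz2 z1T] [z2T az1 az2 disj]]]]]]]].
  have [s1 [t1 [j1 e1]]] := base_chain vn1 bn1.
  have [s2 [t2 [j2 e2]]] := base_chain vn2 bn2.
  subst n1 n2.
  (* Within one block the last chain element would bound both bases. *)
  have nst : ~ (s1 = s2 /\ t1 = t2).
    move=> [? ?]; subst s2 t2.
    case: vn1 vn2 => [lt1 j1b] [_ j2b].
    suff : Lo (Chain s1 t1 13) = Top :> raw by [].
    by apply: disj => //=; order_solve.
  destruct z1 as [| |[]|] => //; destruct z2 as [| |[]|] => //.
  destruct a as [| |[]|] => //; simpl in *; inv_hyps; try (by case: nst); by eexists.
case=> s ->; split=> //.
have [a1 [b1 [a2 [b2 [lt1 lt2 ne s1 s2]]]]] := two_blocks P_nontrivial s.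
exists (Lo (Chain a1 b1 0)), (Lo (Chain a2 b2 0)),
  (Lo (Chain a1 b1 13)), (Lo (Chain a2 b2 13)).
split; first by split.
split; first by split=> //=; try exact: chain_base.
split=> //=; [by case: s1; [right|left]|by case: s2; [right|left]|].
move=> w vw h1 h2; destruct w as [| |[]|] => //; simpl in *; inv_hyps; by case: ne.
Qed.

Lemma is_color_auto F F' a : raw_auto F F' -> raw_valid a ->
  is_color a -> is_color (F a).
Proof.
move=> FF' va [a0 [n1 [n2 [z1 [z2 [[vn1 vn2 vz1 vz2]
    [[bn1 bn2 nz1 nz2 z1T] [z2T az1 az2 disj]]]]]]]].
have vF := auto_valid FF'; have F'F := raw_auto_sym FF'.
split; first by move=> /(auto_eq_bot FF' va).
exists (F n1), (F n2), (F z1), (F z2); split; first by split; apply: vF.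
split.
  split; try (by apply: (base_auto FF')); try exact/(auto_le FF').
  by move=> /(auto_eq_top FF' vz1).
split; try exact/(auto_le FF').
  by move=> /(auto_eq_top FF' vz2).
move=> w vw h1 h2; have vw' := auto_valid F'F vw.
rewrite -(autoK F'F vw) (disj (F' w)) ?(auto_top FF') //.
  by apply/(auto_le FF') => //; rewrite (autoK F'F).
by apply/(auto_le FF') => //; rewrite (autoK F'F).
Qed.

(* Expresses the well-order of colours through the order of the lattice. *)
Definition color_before s t : Prop := exists n z,
  [/\ raw_valid n, raw_valid z & z <> Top] /\
  [/\ raw_le (Lo (Color t)) n, n <> Lo (Color t), raw_le n z,
    raw_le (Lo (Color s)) z & ~ raw_le (Lo (Color s)) n].

(** The only candidates for [n] are the chain elements of the block of [s] and [t] before the last,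
    since [s] enters exactly at the last one. *)
Lemma color_beforeP s t : color_before s t <-> wo_lt s t.
Proof.
split; last first.
  move=> st; exists (Lo (Chain s t 0)), (Lo (Chain s t 13)); split=> //.
  by split=> //=; [left|right|case=> [e|[_]//]; case: st => _; apply].
move=> [n [z [[vn vz zT] [tn nt nz sz sn]]]].
destruct z as [| |z|z] => //; destruct n as [| |n|n] => //.
destruct z, n => //; simpl in *; inv_hyps; try done; try (by case: sn);
  try (by case: sn; left); try tauto.
Qed.
Lemma color_before_auto F F' s t s' t' : raw_auto F F' ->
  F (Lo (Color s)) = Lo (Color s') -> F (Lo (Color t)) = Lo (Color t') ->
  wo_lt s t -> wo_lt s' t'.
Proof.
move=> FF' es et /color_beforeP[n [z [[vn vz zT] [tn nt nz sz sn]]]].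
apply/color_beforeP; exists (F n), (F z); rewrite -es -et.
split; first split; try exact: (auto_valid FF').
  by move=> /(auto_eq_top FF' vz).
split; try (by apply/(auto_le FF')).
  by move=> /(auto_inj FF' vn) /nt; apply.
Qed.

(** The colours are permuted, and the permutation and its inverse preserve the well-order. *)
Lemma auto_color F F' s : raw_auto F F' -> F (Lo (Color s)) = Lo (Color s).
Proof.
have colors H H' : raw_auto H H' ->
    exists sigma, forall s, H (Lo (Color s)) = Lo (Color (sigma s)).
  move=> HH'.
  have /choice[sigma sigmaE] : forall s, exists s',
      H (Lo (Color s)) = Lo (Color s'); last by exists sigma.
  move=> {}s; apply/is_colorP; first exact: (auto_valid HH').
  by apply: (is_color_auto HH') => //; apply/is_colorP => //; exists s.
move=> FF'; have F'F := raw_auto_sym FF'.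
have [sigma sigmaE] := colors _ _ FF'; have [tau tauE] := colors _ _ F'F.
rewrite sigmaE (@wo_auto_id _ sigma tau) //.
- move=> t; have := autoK FF' (a := Lo (Color t)) I.
  by rewrite sigmaE tauE => -[].
- move=> t; have := autoK F'F (a := Lo (Color t)) I.
  by rewrite tauE sigmaE => -[].
- by move=> t u; apply: (color_before_auto FF').
- by move=> t u; apply: (color_before_auto F'F).
Qed.

(** * Blocks, edges and gates are fixed by every automorphism *)

Lemma auto_chain_block F F' s t j : raw_auto F F' -> wo_lt s t -> j < 14 ->
  exists2 j', j' < 14 & F (Lo (Chain s t j)) = Lo (Chain s t j').
Proof.
move=> FF' st j14; have vF := auto_valid FF'.
have fixc := auto_color _ FF'.
(* Besides 1, only the last chain element lies above both [s] and [t]; asymmetry excludes a block in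
   the other order. *)
have top : F (Lo (Chain s t 13)) = Lo (Chain s t 13).
  have vc : raw_valid (Lo (Chain s t 13) : raw) by [].
  have va : raw_valid (F (Lo (Chain s t 13))) by apply: vF.
  have sa : raw_le (Lo (Color s)) (F (Lo (Chain s t 13))).
    by rewrite -fixc; apply/(auto_le FF') => //; right.
  have ta : raw_le (Lo (Color t)) (F (Lo (Chain s t 13))).
    by rewrite -fixc; apply/(auto_le FF') => //; left.
  have nT : F (Lo (Chain s t 13)) <> Top by move=> /(auto_eq_top FF' vc).
  have nst : s <> t by case: st.
  destruct (F (Lo (Chain s t 13))) as [| |x|x] => //.
  destruct x => //; simpl in *; inv_hyps; try done.
  - by congr (Lo (Chain _ _ _)); lia.
  - by case: (wo_lt_asym st).
have vc : raw_valid (Lo (Chain s t j) : raw) by [].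
have va := vF _ vc.
have ta : raw_le (Lo (Color t)) (F (Lo (Chain s t j))).
  by rewrite -fixc; apply/(auto_le FF') => //; left.
have aT : raw_le (F (Lo (Chain s t j))) (Lo (Chain s t 13)).
  by rewrite -top; apply/(auto_le FF') => //=; order_solve.
have nc : F (Lo (Chain s t j)) <> Lo (Color t).
  by rewrite -fixc => e; have := auto_inj FF' vc (b := Lo (Color t)) I e.
destruct (F (Lo (Chain s t j))) as [| |x|x] => //.
destruct x => //; simpl in *; inv_hyps; try done;
  by eexists; [eassumption|reflexivity].
Qed.

(** By induction the smaller indices are fixed, so injectivity prevents [F] and its inverse from
    lowering the index [j]; monotonicity then prevents raising it. *)
Lemma auto_chain F F' s t j : raw_auto F F' -> wo_lt s t -> j < 14 ->
  F (Lo (Chain s t j)) = Lo (Chain s t j).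
Proof.
move=> FF' st; have F'F := raw_auto_sym FF'.
elim/ltn_ind: j => j IHj j14.
have [i i14 ei] := auto_chain_block FF' st j14.
have [i' i'14 ei'] := auto_chain_block F'F st j14.
have fix' l : l < j -> F' (Lo (Chain s t l)) = Lo (Chain s t l).
  move=> lj; have l14 : l < 14 by lia.
  by rewrite -[in LHS](IHj l lj l14) (autoK FF').
have ge_fix H H' l : raw_auto H H' -> l < 14 ->
    (forall m, m < j -> H (Lo (Chain s t m)) = Lo (Chain s t m)) ->
    H (Lo (Chain s t j)) = Lo (Chain s t l) -> j <= l.
  move=> HH' l14 fixm el; rewrite leqNgt; apply/negP => lj.
  have e : H (Lo (Chain s t l)) = H (Lo (Chain s t j)) by rewrite fixm.
  have [lj'] : Lo (Chain s t l) = Lo (Chain s t j) :> raw by apply: (auto_inj HH' _ _ e).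
  by rewrite lj' ltnn in lj.
have ji : j <= i by apply: ge_fix FF' i14 _ ei => m mj; apply: IHj => //; lia.
have ji' : j <= i' by apply: ge_fix F'F i'14 fix' ei'.
suff e' : i' = j by rewrite -[in LHS]e' -ei' (autoK F'F).
have : raw_le (F' (Lo (Chain s t j))) (F' (Lo (Chain s t i))).
  by apply/(auto_le F'F) => //=; order_solve.
by rewrite -ei (autoK FF') // ei' /=; lia.
Qed.

(** The image lies below a fixed chain element and is again a tag of the block; its index is that of
    the least chain element above it. *)
Lemma auto_tag F F' s t j : raw_auto F F' -> wo_lt s t -> j < 13 ->
  F (Lo (Tag s t j)) = Lo (Tag s t j).
Proof.
move=> FF' st j13; have F'F := raw_auto_sym FF'.
have vt : raw_valid (Lo (Tag s t j) : raw) by [].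
have fixc i : i < 14 -> F (Lo (Chain s t i)) = Lo (Chain s t i).
  exact: (auto_chain FF' st).
have va := auto_valid FF' vt.
have aj : raw_le (F (Lo (Tag s t j))) (Lo (Chain s t j)).
  have j14 : j < 14 by lia.
  by rewrite -(fixc _ j14); apply/(auto_le FF').
have K := autoK FF' vt.
destruct (F (Lo (Tag s t j))) as [| |x|x] => //.
  by move: K; rewrite (auto_bot F'F).
destruct x as [c|c c' i|c c' i| | | | | ] => //.
- by move: K; rewrite (auto_color _ F'F).
- by case: va => lt i14; move: K; rewrite (auto_chain F'F lt i14).
- move: aj va K => /= [-> [-> ij]] va K; congr (Lo (Tag _ _ _)).
  have i14 : i < 14 by lia.
  have : raw_le (F' (Lo (Tag s t i))) (F' (Lo (Chain s t i))).
    by apply/(auto_le F'F); rewrite //= leqnn.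
  by rewrite K (auto_chain F'F st i14) /= => -[_ [_]]; lia.
Qed.

(** Above the colour [inr p] there are only that colour, chain elements, [Link p] and 1, and all the
    others are already known to be fixed. *)
Lemma auto_link F F' p : raw_auto F F' -> inner p ->
  F (Lo (Link p)) = Lo (Link p).
Proof.
move=> FF' ip; have F'F := raw_auto_sym FF'.
have vl : raw_valid (Lo (Link p) : raw) by [].
have va := auto_valid FF' vl; have K := autoK FF' vl.
have ca : raw_le (Lo (Color (inr p))) (F (Lo (Link p))).
  by rewrite -(auto_color _ FF'); apply/(auto_le FF').
have nT : F (Lo (Link p)) <> Top by move=> /(auto_eq_top FF' vl).
destruct (F (Lo (Link p))) as [| |x|x] => //.
destruct x as [c|c c' i|c c' i| | | | q| ] => //; simpl in ca.
- by move: K; rewrite (auto_color _ F'F).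
- by case: va => lt i14; move: K; rewrite (auto_chain F'F lt i14).
- by case: ca => ->.
Qed.

Lemma auto_hub_block F F' p k : raw_auto F F' -> inner p -> k < 2 ->
  exists2 k', k' < 2 & F (Lo (Hub p k)) = Lo (Hub p k').
Proof.
move=> FF' ip k2; have F'F := raw_auto_sym FF'.
have vh : raw_valid (Lo (Hub p k) : raw) by [].
have va := auto_valid FF' vh; have K := autoK FF' vh.
have al : raw_le (F (Lo (Hub p k))) (Lo (Link p)).
  by rewrite -(auto_link FF' ip); apply/(auto_le FF').
destruct (F (Lo (Hub p k))) as [| |x|x] => //.
  by move: K; rewrite (auto_bot F'F).
destruct x as [c| | | | |q i|q| ] => //; simpl in al.
- by move: K; rewrite (auto_color _ F'F).
- by case: va => _ i2; exists i; rewrite ?al.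
- by move: K; rewrite (auto_link F'F va).
Qed.

Lemma auto_hub F F' p k : raw_auto F F' -> inner p -> k < 2 ->
  F (Lo (Hub p k)) = Lo (Hub p k).
Proof.
move=> FF' ip k2.
have [k0 k02 e0] := auto_hub_block FF' ip (isT : 0 < 2).
have [k1 k12 e1] := auto_hub_block FF' ip (isT : 1 < 2).
have : raw_le (F (Lo (Hub p 0))) (F (Lo (Hub p 1))) by apply/(auto_le FF').
rewrite e0 e1 /= => -[_ k01].
have k01' : k0 <> k1.
  move=> k01'; have e : F (Lo (Hub p 0)) = F (Lo (Hub p 1)) by rewrite e0 e1 k01'.
  by have : Lo (Hub p 0) = Lo (Hub p 1) :> raw by apply: (auto_inj FF' _ _ e).
have [ek|ek] : k = 0 \/ k = 1 by lia.
- by rewrite ek e0; congr (Lo (Hub _ _)); lia.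
- by rewrite ek e1; congr (Lo (Hub _ _)); lia.
Qed.

(** A gate element is determined by the fixed [Hub] elements below it. *)
Lemma auto_gate F F' p q k : raw_auto F F' -> low_valid (Gate p q k : low P G) ->
  F (Lo (Gate p q k)) = Lo (Gate p q k).
Proof.
move=> FF' vg0; have vg : raw_valid (Lo (Gate p q k) : raw) by [].
case: vg0 => ip [iq [pq k3]].
have va := auto_valid FF' vg.
have hub_le r i : inner r -> i < 2 ->
    raw_le (Lo (Hub r i)) (F (Lo (Gate p q k))) <->
    raw_le (Lo (Hub r i)) (Lo (Gate p q k) : raw).
  by move=> ir i2; rewrite -{1}(auto_hub FF' ir i2); apply: (auto_le FF').
have hp0 := hub_le _ _ ip (isT : 0 < 2); have hq0 := hub_le _ _ iq (isT : 0 < 2).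
have hp1 := hub_le _ _ ip (isT : 1 < 2); have hq1 := hub_le _ _ iq (isT : 1 < 2).
have nT : F (Lo (Gate p q k)) <> Top by move=> /(auto_eq_top FF' vg).
have npq : p <> q by move=> e; rewrite e ltxx in pq.
have pa : raw_le (Lo (Hub p 0)) (F (Lo (Gate p q k))) by apply/hp0; left.
have qa : raw_le (Lo (Hub q 0)) (F (Lo (Gate p q k))) by apply/hq0; right.
destruct (F (Lo (Gate p q k))) as [| |x|x] => //;
  destruct x as [| | | | |r i|r|r s i] => //; simpl in pa, qa.
- by case: npq; case: pa => ->; case: qa => ->.
- by case: npq; rewrite pa qa.
- have [er es] : r = p /\ s = q.
    case: va => _ [_ [rs _]]; inv_hyps; try done.
    by have := lt_asymP rs pq.
  subst r s; case: va => _ [_ [_ i3]]; congr (Lo (Gate _ _ _)).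
  (* The index is recognised by b_p, which lies below b and i but not a, and by b_q, which lies
     below i only. *)
  have e1 : 0 < i <-> 0 < k.
    split=> h.
      by have /= := hp1.1 (or_introl (conj erefl h)); case=> [[]|[/npq]].
    by have /= := hp1.2 (or_introl (conj erefl h)); case=> [[]|[/npq]].
  have e2 : 2 * 1 <= i <-> 2 * 1 <= k.
    split=> h.
      by have /= := hq1.1 (or_intror (conj erefl h)); case=> [[/esym/npq]|[]].
    by have /= := hq1.2 (or_intror (conj erefl h)); case=> [[/esym/npq]|[]].
  lia.
- by case: npq; case: pa => ->; case: qa => ->.
Qed.

(** * The net admits only left translations *)

Lemma auto_edge_block F F' g h : raw_auto F F' ->
  exists g' h', F (Lo (Edge g h)) = Lo (Edge g' h') /\ (g'^-1 * h' = g^-1 * h)%g.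
Proof.
move=> FF'; have F'F := raw_auto_sym FF'.
have ve : raw_valid (Lo (Edge g h) : raw) by [].
have va := auto_valid FF' ve; have K := autoK FF' ve.
have ca : raw_le (Lo (Color (inl (g^-1 * h)%g))) (F (Lo (Edge g h))).
  by rewrite -(auto_color _ FF'); apply/(auto_le FF').
have nT : F (Lo (Edge g h)) <> Top by move=> /(auto_eq_top FF' ve).
destruct (F (Lo (Edge g h))) as [| |x|x] => //.
destruct x as [c|c c' i|c c' i| |g' h'| | | ] => //; simpl in ca.
- by move: K; rewrite (auto_color _ F'F).
- by case: va => lt i14; move: K; rewrite (auto_chain F'F lt i14).
- by exists g', h'; split=> //; case: ca.
Qed.

Lemma auto_vert_block F F' (b : bool) g : raw_auto F F' ->
  exists (b' : bool) g', F (Lo (Vert b g)) = Lo (Vert b' g').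
Proof.
move=> FF'; have F'F := raw_auto_sym FF'.
have vv : raw_valid (Lo (Vert b g) : raw) by [].
have K := autoK FF' vv.
have [g' [h' [ee _]]] := auto_edge_block g g FF'.
have ae : raw_le (F (Lo (Vert b g))) (Lo (Edge g' h')).
  by rewrite -ee; apply/(auto_le FF') => //=; case: (b).
destruct (F (Lo (Vert b g))) as [| |x|x] => //.
  by move: K; rewrite (auto_bot F'F).
destruct x as [c| | |b1 g1|g1 h1| | | ] => //; simpl in ae.
- by move: K; rewrite (auto_color _ F'F).
- by exists b1, g1.
- by case: ae => e1 e2; move: K; rewrite e1 e2 -ee (autoK FF').
Qed.

(* A Vert false element lies below its dual copy, which is above no colour. *)
Lemma auto_vert_false F F' g : raw_auto F F' ->
  exists g', F (Lo (Vert false g)) = Lo (Vert false g').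
Proof.
move=> FF'; have F'F := raw_auto_sym FF'.
have [[] [g' e]] := auto_vert_block false g FF'; last by exists g'.
have vh : raw_valid (Hi (Vert false g) : raw) by [].
have K := autoK FF' vh.
have le : raw_le (Lo (Vert true g')) (F (Hi (Vert false g))).
  by rewrite -e; apply/(auto_le FF').
have nT : F (Hi (Vert false g)) <> Top by move=> /(auto_eq_top FF' vh).
destruct (F (Hi (Vert false g))) as [| |x|x] => //.
destruct x as [| | |[] g1|g1 h1| | | ] => //; simpl in le.
- by case: le => _ eg; move: K; rewrite -eg -e (autoK FF').
- by case: le.
- have : raw_le (F' (Lo (Color (inl (g1^-1 * h1)%g)))) (F' (Lo (Edge g1 h1))).
    by apply/(auto_le F'F).
  by rewrite K (auto_color _ F'F).
Qed.

Lemma auto_vert_true F F' g : raw_auto F F' ->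
  exists g', F (Lo (Vert true g)) = Lo (Vert true g').
Proof.
move=> FF'; have F'F := raw_auto_sym FF'.
have [[] [g' e]] := auto_vert_block true g FF'; first by exists g'.
have [g1 e1] := auto_vert_false g' F'F.
by have := autoK FF' (a := Lo (Vert true g)) I; rewrite e e1.
Qed.

Definition low_act (k : G) x : low P G :=
  match x with
  | Vert b g => Vert b (k * g)%g
  | Edge g h => Edge (k * g)%g (k * h)%g
  | _ => x
  end.

Definition raw_act (k : G) a : raw :=
  match a with
  | Lo x => Lo (low_act k x)
  | Hi x => Hi (low_act k x)
  | _ => a
  end.

(** The two kinds of points are moved by maps [alpha] and [beta] of the group. Since lines keep
    their colour, [beta h] is [alpha 1 * h], and then the lines with [h = g] force [alpha g] to be
    [alpha 1 * g]. *)
Lemma auto_low F F' : raw_auto F F' ->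
  exists k, forall x, low_valid x -> F (Lo x) = Lo (low_act k x).
Proof.
move=> FF'.
have /choice[alpha alphaE] : forall g, exists g',
    F (Lo (Vert false g)) = Lo (Vert false g').
  by move=> g; apply: auto_vert_false FF'.
have /choice[beta betaE] : forall g, exists g',
    F (Lo (Vert true g)) = Lo (Vert true g').
  by move=> g; apply: auto_vert_true FF'.
have edge g h : F (Lo (Edge g h)) = Lo (Edge (alpha g) (beta h)) /\
    ((alpha g)^-1 * beta h = g^-1 * h)%g.
  have [g' [h' [e ec]]] := auto_edge_block g h FF'.
  have : raw_le (F (Lo (Vert false g))) (F (Lo (Edge g h))) by apply/(auto_le FF').
  have : raw_le (F (Lo (Vert true h))) (F (Lo (Edge g h))) by apply/(auto_le FF').
  by rewrite alphaE betaE e /= => -> ->.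
have betaM h : beta h = (alpha 1 * h)%g.
  by have [_] := edge 1%g h; rewrite invg1 mul1g => e; rewrite -{2}e mulVKg.
have alphaM g : alpha g = (alpha 1 * g)%g.
  have [_] := edge g g; rewrite mulVg betaM => e.
  by rewrite -[LHS]mulg1 -[X in (_ * X)%g = _]e mulVKg.
exists (alpha 1%g) => -[s|s t j|s t j|b g|g h|p k|p|p q k] vx /=.
- exact: auto_color FF'.
- by case: vx => st j14; apply: auto_chain FF' st j14.
- by case: vx => st j13; apply: auto_tag FF' st j13.
- by destruct b; rewrite ?betaE ?alphaE ?betaM -?alphaM.
- by have [-> _] := edge g h; rewrite betaM (alphaM g).
- by case: vx => ip k2; apply: auto_hub FF' ip k2.
- exact: auto_link FF' vx.
- exact: auto_gate FF' vx.
Qed.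

Lemma auto_raw_act F F' : raw_auto F F' ->
  exists k, forall a, raw_valid a -> F a = raw_act k a.
Proof.
move=> FF'; have FF's := raw_auto_star FF'.
have [k kE] := auto_low FF'; have [k' k'E] := auto_low FF's.
have hiE x : low_valid x -> F (Hi x) = Hi (low_act k' x).
  by move=> vx; have := k'E x vx => /= /(congr1 raw_star); rewrite raw_starK.
(* A point [Vert false g] lies below its own dual, so both copies undergo the same translation. *)
have kk' : k = k'.
  have : raw_le (F (Lo (Vert false 1%g))) (F (Hi (Vert false 1%g))).
    by apply/(auto_le FF').
  by rewrite kE // hiE //= !mulg1.
exists k => -[||x|x] vx.
- exact: auto_bot FF'.
- exact: auto_top FF'.
- exact: kE.
- by rewrite hiE // -kk'.
Qed.

End Automorphisms.

(** * The action of the group on the lattice *)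

Lemma order_iso_lattice_iso d (L : latticeType d) (f g : L -> L) :
  cancel f g -> cancel g f -> {homo f : x y / (x <= y)%O} ->
  {homo g : x y / (x <= y)%O} -> lattice_isomorphism f.
Proof.
move=> fK gK f_homo g_homo.
have f_mono : {mono f : x y / (x <= y)%O}.
  by move=> x y; apply/idP/idP => [/g_homo|/f_homo//]; rewrite !fK.
split; first by exists g.
- move=> x y; apply/le_anti; rewrite lexI !f_mono leIl leIr andbT /=.
  by rewrite -[X in (X <= _)%O]gK f_mono lexI -![(g _ <= _)%O]f_mono !gK leIl leIr.
- move=> x y; apply/le_anti; rewrite leUx !f_mono leUl leUr andbT /=.
  by rewrite -[X in (_ <= X)%O]gK f_mono leUx -![(_ <= g _)%O]f_mono !gK leUl leUr.
Qed.

Lemma meet_morphism_le d (L : latticeType d) (f : L -> L) :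
  Order.meet_morphism f -> {homo f : x y / (x <= y)%O}.
Proof. by move=> fI x y /meet_idPl xy; apply/meet_idPl; rewrite -fI xy. Qed.

Section GroupAction.
Context {dP : Order.disp_t} {P : tbPOrderType dP} {G : groupType}.
Local Notation L := (elt P G).
Implicit Types (a b : raw P G) (k l : G).

Lemma raw_act_valid k a : raw_valid a -> raw_valid (raw_act k a).
Proof. by case: a => // -[]. Qed.

(** Left translations preserve the colour [g^-1 * h] of a line. *)
Lemma low_act_le k (x y : low P G) :
  low_le x y -> low_le (low_act k x) (low_act k y).
Proof.
case: x y => [s|s t j|s t j|b g|g h|p i|p|p q i] [] //=.
- by move=> g h ->; rewrite invgM -mulgA mulKg.
- by move=> b' g' [-> ->].
- by move=> g' h' ->; case: (b).
- by move=> g' h' [-> ->].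
Qed.

Lemma raw_act_le k a b : raw_le a b -> raw_le (raw_act k a) (raw_act k b).
Proof.
case: a b => [||x|x] [||y|y] //=; try exact: low_act_le.
by move=> xy; destruct x as [| | |[] g| | | |], y as [| | |[] h| | | |] => //;
  rewrite /= xy.
Qed.

Lemma raw_actM k l a : raw_act (k * l)%g a = raw_act k (raw_act l a).
Proof. by case: a => // -[] //= *; rewrite !mulgA. Qed.

Lemma raw_act1 a : raw_act 1%g a = a.
Proof. by case: a => // -[] //= *; rewrite !mul1g. Qed.

Definition elt_act k (u : L) : L :=
  exist _ (raw_act k (sval u)) (raw_act_valid k (svalP u)).

Lemma elt_actM k l u : elt_act (k * l)%g u = elt_act k (elt_act l u).
Proof. exact/elt_inj/raw_actM. Qed.

Lemma elt_act_iso k : lattice_isomorphism (elt_act k).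
Proof.
have act1 u : elt_act 1%g u = u by exact/elt_inj/raw_act1.
have homo l : {homo elt_act l : u v / (u <= v)%O}.
  by move=> u v /elt_leP uv; apply/elt_leP/raw_act_le.
by apply: (@order_iso_lattice_iso _ _ _ (elt_act k^-1%g)) => // u;
  rewrite -elt_actM ?mulVg ?mulgV act1.
Qed.

Lemma elt_aut (P_nontrivial : (\bot%O : P) <> \top%O) : group_isomorphic_Aut G L.
Proof.
exists elt_act; split; last by move=> k l; apply: funext => u; apply: elt_actM.
split.
- by move=> k _; apply: elt_act_iso.
- move=> k l _ _ kl.
  (* The translating element is read off from the image of the point at the unit. *)
  have := congr1 (fun f : L -> L => sval (f (el (Lo (Vert false 1%g))))) kl.
  by rewrite /= sval_el //= !mulg1 => -[].
- move=> f [[g fK gK] fI _]; have f_homo := meet_morphism_le fI.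
  have g_homo : {homo g : u v / (u <= v)%O}.
    apply: meet_morphism_le => u v.
    by apply: (can_inj fK); rewrite fI !gK.
  have FF' : raw_auto (fun a => sval (f (el a))) (fun a => sval (g (el a))).
    split=> [a va|a va|a b va vb ab|a b va vb ab].
    + by split; apply: svalP.
    + by rewrite !el_sval fK gK sval_el.
    + by apply/elt_leP/f_homo/le_el.
    + by apply/elt_leP/g_homo/le_el.
  have [k kE] := auto_raw_act P_nontrivial FF'.
  exists k => //; apply: funext => u; apply: elt_inj.
  by have := kE _ (svalP u); rewrite el_sval.
Qed.

End GroupAction.

Theorem theorem1p1 (dP : Order.disp_t) (P : tbPOrderType dP) (G : groupType)
    (hP : exists x y : P, x <> y) :
  exists (d : Order.disp_t) (L : latticeType d),
    [/\ selfdual L, has_length L 16, order_isomorphic_Princ L P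
      & group_isomorphic_Aut G L].
Proof.
have P_nontrivial : (\bot%O : P) <> \top%O.
  move=> bt; have [x [y]] := hP; apply; apply/le_anti/andP.
  by split; apply: le_trans (lex1 _) _; rewrite -bt le0x.
(* One block is enough to attain the length. *)
have [s [t [_ [_ [st _ _ _ _]]]]] := two_blocks P_nontrivial (inl 1%g : color P G).
exists elt_display, (elt P G); split.
- exact: elt_selfdual.
- exact: elt_length st.
- exact: elt_princ.
- exact: elt_aut.
Qed.
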